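(* Let $p>1$ and let $\omega:[0,\infty[\to[0,\infty[$ be given by $\omega(x)=0$ for $0\le x\le 1$ and $\omega(x)=(\log x)^p$ for $x>1$. Let $\psi$ be a polynomial with real coefficients of degree greater than one. Then the following statements are equivalent: (1) $C_\psi:\mathcal{S}_\omega(\mathbb{R})\to\mathcal{S}_\omega(\mathbb{R})$ is power bounded; (2) $\psi$ lacks fixed points, i.e. there is no $x\in\mathbb{R}$ with $\psi(x)=x$; (3) $C_\psi:\mathcal{S}_\omega(\mathbb{R})\to\mathcal{S}_\omega(\mathbb{R})$ is mean ergodic.
   Context: $\mathbb{N}=\{1,2,\dots\}$, $\mathbb{N}_0=\mathbb{N}\cup\{0\}$. Put $\varphi_\omega(t)=\omega(e^t)$ and let $\varphi_\omega^*(s)=\sup\{st-\varphi_\omega(t): t\ge 0\}$, $s\ge 0$, be its Young conjugate. The Gelfand-Shilov space of Beurling type $\mathcal{S}_\omega(\mathbb{R})$ is the space of all $f\in C^\infty(\mathbb{R})$ (complex valued) with $$\|f\|_{\omega,\lambda}:=\sup_{x\in\mathbb{R}}\sup_{n,q\in\mathbb{N}_0}(1+|x|)^q|f^{(n)}(x)|\exp\left(-\lambda\varphi_\omega^*\left(\tfrac{n+q}{\lambda}\right)\right)<\infty\quad\text{for every }\lambda>0,$$ a Fréchet space with the topology given by these seminorms. $C_\psi$ is the composition operator $f\mapsto f\circ\psi$; for this $\omega$ and every such polynomial $\psi$ it maps $\mathcal{S}_\omega(\mathbb{R})$ continuously into itself. A continuous linear operator $T:X\to X$ on a Fréchet space $X$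 is power bounded if the sequence of iterates $(T^m)_{m\in\mathbb{N}}$ is equicontinuous, and mean ergodic if $\lim_{n}\frac1n\sum_{k=1}^nT^k(x)$ exists in $X$ for every $x\in X$. *)

(* Defs.v *)
From HB Require Import structures.
From mathcomp Require Import all_boot all_order all_algebra.
From mathcomp Require Import all_classical all_reals all_analysis.
From mathcomp Require Import complex.

Set Implicit Arguments.
Unset Strict Implicit.
Unset Printing Implicit Defensive.

Import Order.TTheory GRing.Theory Num.Theory.
Import numFieldNormedType.Exports.
Import ComplexField.Normc.

Local Open Scope classical_set_scope.
Local Open Scope ring_scope.

Section ComplexValuedSmoothFunctions.
Variable R : realType.
Implicit Types (u v : R -> R) (f g : R -> R[i]).

Definition smooth u := forall (n : nat) (x : R), derivable (derive1n n u) x 1.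

(* R[i] carries no real normed-module structure in the library, hence the
   componentwise derivatives. *)
Definition csmooth f :=
  smooth (fun x => complex.Re (f x)) /\ smooth (fun x => complex.Im (f x)).

Definition cderive (n : nat) f (x : R) : R[i] :=
  Complex (derive1n n (fun y => complex.Re (f y)) x)
          (derive1n n (fun y => complex.Im (f y)) x).

Lemma derive1n_lincomb (a b : R) u v n : smooth u -> smooth v ->
  derive1n n (fun x => a * u x + b * v x) = (fun x => a * derive1n n u x + b * derive1n n v x).
Proof.
move=> su sv; elim: n => [|n IHn]; first by rewrite !derive1n0.
rewrite derive1nS IHn; apply/funext => x.
rewrite derive1E.
have -> : (fun x => a * derive1n n u x + b * derive1n n v x)
    = (a *: derive1n n u) + (b *: derive1n n v) by apply/funext.
rewrite deriveD; [|exact: derivableZ (su n x)|exact: derivableZ (sv n x)].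
rewrite deriveZ; last exact: su.
rewrite deriveZ; last exact: sv.
by rewrite !derive1nS !derive1E.
Qed.

Lemma smooth_lincomb (a b : R) u v : smooth u -> smooth v ->
  smooth (fun x => a * u x + b * v x).
Proof.
move=> su sv n x; rewrite derive1n_lincomb//.
have -> : (fun x => a * derive1n n u x + b * derive1n n v x)
    = (a *: derive1n n u) + (b *: derive1n n v) by apply/funext.
by apply: derivableD; apply: derivableZ; [exact: su|exact: sv].
Qed.

Let ReD f g : (fun x => complex.Re ((f + g) x))
  = (fun x => 1 * complex.Re (f x) + 1 * complex.Re (g x)).
Proof. by apply/funext => x; rewrite !mul1r fctE raddfD. Qed.

Let ImD f g : (fun x => complex.Im ((f + g) x))
  = (fun x => 1 * complex.Im (f x) + 1 * complex.Im (g x)).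
Proof. by apply/funext => x; rewrite !mul1r fctE raddfD. Qed.

Let ReZ c f : (fun x => complex.Re ((c *: f) x))
  = (fun x => complex.Re c * complex.Re (f x)
            + (- complex.Im c) * complex.Im (f x)).
Proof.
by apply/funext => x; rewrite fctE /GRing.scale/=; case: c => a b; case: (f x) => ? ?/=; rewrite mulNr.
Qed.

Let ImZ c f : (fun x => complex.Im ((c *: f) x))
  = (fun x => complex.Im c * complex.Re (f x)
            + complex.Re c * complex.Im (f x)).
Proof.
by apply/funext => x; rewrite fctE /GRing.scale/=; case: c => a b; case: (f x) => ? ?/=; rewrite addrC.
Qed.

Lemma csmoothD f g : csmooth f -> csmooth g -> csmooth (f + g).
Proof.
by move=> [fr fi] [gr gi]; split; rewrite ?ReD ?ImD; apply: smooth_lincomb.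
Qed.

Lemma csmoothZ c f : csmooth f -> csmooth (c *: f).
Proof.
by move=> [fr fi]; split; rewrite ?ReZ ?ImZ; apply: smooth_lincomb.
Qed.

Lemma cderiveD f g n x : csmooth f -> csmooth g ->
  cderive n (f + g) x = cderive n f x + cderive n g x.
Proof.
move=> [fr fi] [gr gi]; rewrite /cderive ReD ImD !derive1n_lincomb//.
by rewrite !mul1r.
Qed.

Lemma cderiveZ c f n x : csmooth f ->
  cderive n (c *: f) x = c * cderive n f x.
Proof.
move=> [fr fi]; rewrite /cderive ReZ ImZ !derive1n_lincomb//.
by case: c => a b /=; rewrite mulNr [X in Complex _ X]addrC.
Qed.

Lemma csmooth0 : csmooth (0 : R -> R[i]).
Proof.
have H : smooth (cst 0 : R -> R).
  have E n : derive1n n (cst 0 : R -> R) = cst 0.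
    elim: n => [|n IH]; first by rewrite derive1n0.
    by rewrite derive1nS IH; apply/funext => y; rewrite derive1_cst.
  by move=> n x; rewrite E; exact: derivable_cst.
by split; exact: H.
Qed.

Lemma cderive0 n x : cderive n (0 : R -> R[i]) x = 0.
Proof.
have := cderiveZ 0 n x csmooth0.
by rewrite scale0r mul0r.
Qed.

End ComplexValuedSmoothFunctions.

Section GelfandShilov.
Variable R : realType.
Implicit Types (omega : R -> R) (f g : R -> R[i]).

Definition young_conjugate (phi : R -> R) (s : R) : \bar R :=
  ereal_sup [set (s * t - phi t)%:E | t in [set t : R | 0 <= t]].

Definition weight_phi omega (t : R) : R := omega (expR t).

Definition gs_term omega (lambda : R) f (x : R) (n q : nat) : \bar R :=
  (((1 + `|x|) ^+ q * normc (cderive n f x))%:E *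
   expeR (- (lambda%:E *
             young_conjugate (weight_phi omega) ((n + q)%:R / lambda))))%E.

Definition gs_seminorm omega (lambda : R) f : \bar R :=
  ereal_sup [set y | exists (x : R) (n q : nat),
                       y = gs_term omega lambda f x n q].

Definition is_gelfand_shilov omega f : Prop :=
  csmooth f /\
  forall lambda : R, 0 < lambda -> (gs_seminorm omega lambda f < +oo)%E.

Lemma normc_ge0 (z : R[i]) : 0 <= normc z.
Proof. by case: z => a b /=; exact: sqrtr_ge0. Qed.

Lemma gs_coef_ge0 (x : R) q (z : R[i]) : 0 <= (1 + `|x|) ^+ q * normc z.
Proof. by rewrite mulr_ge0 ?normc_ge0// exprn_ge0// addr_ge0. Qed.

Lemma gs_term_le omega lambda f x n q :
  (gs_term omega lambda f x n q <= gs_seminorm omega lambda f)%E.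
Proof. by apply: ereal_sup_ubound; exists x, n, q. Qed.

Lemma gs_seminorm_ge0 omega lambda f : (0 <= gs_seminorm omega lambda f)%E.
Proof.
apply: le_trans (gs_term_le _ _ _ 0 0 0).
by rewrite mule_ge0 ?expeR_ge0// lee_fin gs_coef_ge0.
Qed.

Lemma gs_seminormD omega lambda f g : csmooth f -> csmooth g ->
  (gs_seminorm omega lambda (f + g)%R
     <= gs_seminorm omega lambda f + gs_seminorm omega lambda g)%E.
Proof.
move=> sf sg; apply: ge_ereal_sup => _ [x [n [q ->]]].
apply: (@le_trans _ _
  (gs_term omega lambda f x n q + gs_term omega lambda g x n q)%E); last first.
  by apply: leeD; exact: gs_term_le.
rewrite /gs_term -ge0_muleDl ?lee_fin ?gs_coef_ge0//.
rewrite lee_wpmul2r ?expeR_ge0// -EFinD lee_fin cderiveD// -mulrDr.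
by rewrite ler_wpM2l ?le_normcD// exprn_ge0// addr_ge0.
Qed.

Lemma gs_seminormZ_le omega lambda c f : csmooth f ->
  (gs_seminorm omega lambda (c *: f)%R
     <= (normc c)%:E * gs_seminorm omega lambda f)%E.
Proof.
move=> sf; apply: ge_ereal_sup => _ [x [n [q ->]]].
have -> : gs_term omega lambda (c *: f) x n q
    = ((normc c)%:E * gs_term omega lambda f x n q)%E.
  by rewrite /gs_term cderiveZ// normcM muleA -EFinM mulrCA.
by rewrite lee_wpmul2l ?lee_fin ?normc_ge0// gs_term_le.
Qed.

Lemma gs_seminorm0 omega lambda : gs_seminorm omega lambda 0 = 0%E.
Proof.
apply/eqP; rewrite eq_le gs_seminorm_ge0 andbT.
apply: ge_ereal_sup => _ [x [n [q ->]]].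
by rewrite /gs_term cderive0 normc0 mulr0 mul0e.
Qed.

Definition gs_pred omega : {pred (R -> R[i])} :=
  fun f => `[< is_gelfand_shilov omega f >].

Lemma gs_predP omega f : reflect (is_gelfand_shilov omega f)
  (f \in gs_pred omega).
Proof. exact: asboolP. Qed.

Lemma gs_pred_submod omega : GRing.submod_closed (gs_pred omega).
Proof.
split.
  by apply/gs_predP; split=> [|l l0]; [exact: csmooth0|rewrite gs_seminorm0].
move=> c f g /gs_predP[sf ff] /gs_predP[sg fg]; apply/gs_predP.
have scf := csmoothZ c sf.
split; first exact: csmoothD.
move=> l l0; apply: le_lt_trans (gs_seminormD _ _ scf sg) _.
rewrite lte_add_pinfty ?fg//.
apply: le_lt_trans (gs_seminormZ_le _ _ _ sf) _.
by rewrite lte_mul_pinfty ?lee_fin ?normc_ge0// ff.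
Qed.

HB.instance Definition _ omega :=
  GRing.isSubmodClosed.Build R[i] (R -> R[i]) (gs_pred omega)
    (gs_pred_submod omega).

Record gelfand_shilov omega := GelfandShilov {
  gs_val :> R -> R[i];
  _ : gs_val \in gs_pred omega }.

HB.instance Definition _ omega := [isSub for @gs_val omega].
HB.instance Definition _ omega := [Choice of gelfand_shilov omega by <:].
HB.instance Definition _ omega :=
  [SubChoice_isSubLmodule of gelfand_shilov omega by <:].

(* Uniform structure generated by the whole family of seminorms: its basic
   entourages are finite intersections of the sets
   {(f, g) | gs_seminorm omega lambda (f - g) < e}. *)
Definition gs_basic_entourage omega (s : seq R) (e : R) :
    set (gelfand_shilov omega * gelfand_shilov omega) :=
  [set fg | forall lambda : R, lambda \in s ->
    (gs_seminorm omega lambda (gs_val (fg.1 - fg.2)%R) < e%:E)%E].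

Definition gs_entourage omega :
    set_system (gelfand_shilov omega * gelfand_shilov omega) :=
  [set E | exists (s : seq R) (e : R),
    [/\ all (fun lambda => 0 < lambda) s, 0 < e &
        gs_basic_entourage s e `<=` E]].

Lemma gs_csmooth omega (f : gelfand_shilov omega) : csmooth (gs_val f).
Proof. by have /gs_predP[] := valP f. Qed.

Lemma gs_valD omega (f g : gelfand_shilov omega) :
  gs_val (f + g) = gs_val f + gs_val g.
Proof. by []. Qed.

Lemma gs_valZ omega c (f : gelfand_shilov omega) :
  gs_val (c *: f) = c *: gs_val f.
Proof. by []. Qed.

Lemma gs_entourage_filter omega : Filter (@gs_entourage omega).
Proof.
split.
- by exists [::], 1; split.
- move=> A B [s [e [s0 e0 sA]]] [t [d [t0 d0 tB]]].
  exists (s ++ t), (Num.min e d); split.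
  + by rewrite all_cat s0.
  + by rewrite lt_min e0.
  + move=> fg H; split.
      apply: sA => l ls; apply: lt_le_trans (H l _) _.
        by rewrite mem_cat ls.
      by rewrite lee_fin ge_min lexx.
    apply: tB => l lt; apply: lt_le_trans (H l _) _.
      by rewrite mem_cat lt orbT.
    by rewrite lee_fin ge_min lexx orbT.
- move=> A B AB [s [e [s0 e0 sA]]]; exists s, e; split => //.
  exact: subset_trans sA AB.
Qed.

Lemma gs_entourage_diagonal omega (A : set _) :
  @gs_entourage omega A -> diagonal `<=` A.
Proof.
move=> [s [e [s0 e0 sA]]] fg /= fgE; apply: sA => l ls.
by rewrite fgE subrr gs_seminorm0 lte_fin.
Qed.

Lemma gs_entourage_inv omega (A : set _) :
  @gs_entourage omega A -> gs_entourage (A^-1)%relation.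
Proof.
move=> [s [e [s0 e0 sA]]]; exists s, e; split => // -[f g] H.
apply: sA => l /H; apply: le_lt_trans.
change (gs_seminorm omega l (gs_val (g - f)%R)
  <= gs_seminorm omega l (gs_val (f - g)%R))%E.
have -> : (g - f)%R = (-1 *: (f - g))%R by rewrite scaleN1r opprB.
rewrite gs_valZ.
apply: le_trans (gs_seminormZ_le omega l (-1) (gs_csmooth (f - g))) _.
by rewrite normcN normc1 mul1e.
Qed.

Lemma gs_entourage_split omega (A : set _) : @gs_entourage omega A ->
  exists2 B, gs_entourage B & (B \; B `<=` A)%relation.
Proof.
move=> [s [e [s0 e0 sA]]].
exists (gs_basic_entourage s (e / 2)).
  by exists s, (e / 2); split => //; rewrite divr_gt0.
move=> [f h] [g fg gh]; apply: sA => l ls.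
change (gs_seminorm omega l (gs_val (f - h)%R) < e%:E)%E.
have -> : (f - h)%R = ((f - g) + (g - h))%R by rewrite addrA subrK.
rewrite gs_valD.
apply: le_lt_trans
  (gs_seminormD omega l (gs_csmooth (f - g)) (gs_csmooth (g - h))) _.
by rewrite [e]splitr EFinD lteD//; [exact: fg|exact: gh].
Qed.

HB.instance Definition _ omega := isUniform.Build (gelfand_shilov omega)
  (@gs_entourage_filter omega) (@gs_entourage_diagonal omega)
  (@gs_entourage_inv omega) (@gs_entourage_split omega).

HB.instance Definition _ omega :=
  isPointed.Build (gelfand_shilov omega) 0.

(* The default value 0 is only reached when f \o psi leaves the space, which
   does not happen for log_power_weight p, p > 1, and psi a polynomial of
   degree greater than one. *)
Definition composition_operator omega (psi : R -> R)
    (f : gelfand_shilov omega) : gelfand_shilov omega :=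
  insubd (0 : gelfand_shilov omega) (gs_val f \o psi).

End GelfandShilov.

Definition power_bounded (X : puniformType) (T : X -> X) : Prop :=
  @equicontinuous X X nat [set m : nat | (0 < m)%N] (fun m => iter m T).

Definition cesaro_mean (K : fieldType) (X : lmodType K) (T : X -> X) (x : X)
    (n : nat) : X :=
  n%:R^-1 *: \sum_(1 <= k < n.+1) iter k T x.

Definition mean_ergodic (K : numFieldType) (X : PreUniformLmodule.type K)
    (T : X -> X) : Prop :=
  forall x : X, exists y : X, cesaro_mean T x @ \oo --> y.

Definition log_power_weight (R : realType) (p x : R) : R :=
  if x <= 1 then 0 else ln x `^ p.

(* Main.v *)
Require Import Defs.
From HB Require Import structures.
From mathcomp Require Import all_boot all_order all_algebra.
From mathcomp Require Import all_classical all_reals all_analysis.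
From mathcomp Require Import complex.
From mathcomp Require Import ring lra zify.

(** Scaling gives phi*(s) = c s^r with r = p / (p - 1), so the seminorms amount to
    the weights exp (a (n + q)^r) with a > 0 arbitrary; since r > 1 these absorb
    factors N! C^N and, after shrinking a, replacing N = n + q by a multiple of N.
    Hence f |-> f \o P is bounded, uniformly over a family of polynomials P, once
    for a fixed A and k the Taylor coefficients of each P at x are dominated by
    (A (1 + |P x|)^k)^n and 1 + |x| <= A (1 + |P x|).

    If psi has no fixed point, psi x - x is bounded away from 0 with constant sign,
    so an orbit spends a bounded number of steps in a compact set and then escapes
    superexponentially; the product of the expansion rates along an orbit is then
    polynomially bounded in its endpoint.  All iterates of psi lie in one such
    family, and |psi_m x| + 1 >= c m even makes f \o psi_m tend to 0 like 1 / m.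

    If psi has a fixed point, phi = psi \o psi has a non-attracting one x0:
    phi = X + (X - x0)^l g with g x0 <> 0, and g x0 > 0 when l = 1.  For a Gaussian f
    with f' x0 <> 0 the l-th derivative of f \o phi_n at x0 grows at least linearly
    in n, whereas power boundedness or mean ergodicity would make it o(n). *)

Set Implicit Arguments.
Unset Strict Implicit.
Unset Printing Implicit Defensive.

Import Order.TTheory GRing.Theory Num.Theory.
Import numFieldNormedType.Exports.
Import ComplexField.Normc.

Local Open Scope classical_set_scope.
Local Open Scope ring_scope.

(** * Majorants and Taylor expansions of polynomials *)

Section Majorants.
Variable R : realFieldType.
Implicit Types (P Q A B : {poly R}) (s t u x : R).

(** Cauchy's coefficientwise majorants. They force [Q] to have nonnegative coefficients, so [Q] is
    nondecreasing on [0, +oo), and they survive composition, which makes iterates accessible. *)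
Definition majorant P Q := forall i, `|P`_i| <= Q`_i.

Lemma majorant_ge0 P Q i : majorant P Q -> 0 <= Q`_i.
Proof. by move=> /(_ i); apply: le_trans. Qed.

Lemma majorantD P Q A B :
  majorant P Q -> majorant A B -> majorant (P + A) (Q + B).
Proof.
move=> PQ AB i; rewrite !coefD; apply: le_trans (ler_normD _ _) _.
exact: lerD.
Qed.

Lemma majorantM P Q A B :
  majorant P Q -> majorant A B -> majorant (P * A) (Q * B).
Proof.
move=> PQ AB i; rewrite !coefM; apply: le_trans (ler_norm_sum _ _ _) _.
by apply: ler_sum => j _; rewrite normrM ler_pM.
Qed.

Lemma majorantC c : majorant c%:P `|c|%:P.
Proof. by move=> i; rewrite !coefC; case: eqP; rewrite ?normr0. Qed.

Lemma majorantX : majorant 'X 'X.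
Proof. by move=> i; rewrite coefX normr_nat. Qed.

Lemma majorantXn P Q n : majorant P Q -> majorant (P ^+ n) (Q ^+ n).
Proof.
move=> PQ; elim: n => [|n IHn]; last by rewrite !exprS; exact: majorantM.
by have := majorantC 1; rewrite normr1 !expr0.
Qed.

Lemma majorant_comp P Q A B :
  majorant P Q -> majorant A B -> majorant (P \Po A) (Q \Po B).
Proof.
move=> + AB; elim/poly_ind: P Q => [|P c IHP] Q PQ.
  move=> i; rewrite comp_poly0 coef0 normr0.
  rewrite comp_polyE coef_sum sumr_ge0// => j _.
  rewrite coefZ mulr_ge0 ?(majorant_ge0 _ PQ)//.
  exact: (majorant_ge0 _ (majorantXn _ AB)).
have Qc : `|c| <= Q`_0.
  by have := PQ 0; rewrite coefD coefMX coefC add0r.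
(* The induction splits [P] in Horner form; the arbitrary majorant [Q] has to be split the same
   way. *)
have QE : Q = (\poly_(i < size Q) Q`_i.+1) * 'X + (Q`_0)%:P.
  apply/polyP => -[|i]; rewrite coefD coefMX coefC/= ?add0r// addr0 coef_poly.
  by case: ltnP => // /leqW /(nth_default 0) ->.
rewrite QE !comp_polyD !comp_polyM !comp_polyX !comp_polyC.
apply: majorantD; last first.
  by move=> i; rewrite !coefC; case: eqP; rewrite ?normr0.
apply: majorantM => //; apply: IHP => i; rewrite coef_poly.
have := PQ i.+1; rewrite coefD coefMX coefC/= addr0 => PQi.
by case: ltnP => // /leqW /(nth_default 0) Qi; rewrite Qi in PQi.
Qed.

Lemma horner_le P Q s t : majorant P Q -> 0 <= s -> s <= t -> Q.[s] <= Q.[t].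
Proof.
move=> PQ s0 st; rewrite !horner_coef; apply: ler_sum => i _.
rewrite ler_wpM2l ?(majorant_ge0 _ PQ)// lerXn2r// nnegrE//.
exact: le_trans st.
Qed.

Lemma horner_majorant_ge0 P Q s : majorant P Q -> 0 <= s -> 0 <= Q.[s].
Proof.
move=> PQ s0; rewrite horner_coef sumr_ge0// => i _.
by rewrite mulr_ge0 ?(majorant_ge0 _ PQ)// exprn_ge0.
Qed.

Lemma coef_majorant_le P Q n s :
  majorant P Q -> 0 <= s -> `|P`_n| * s ^+ n <= Q.[s].
Proof.
move=> PQ s0; apply: (@le_trans _ _ (Q`_n * s ^+ n)).
  by rewrite ler_wpM2r ?exprn_ge0.
have [nQ|Qn] := ltnP n (size Q); last first.
  by rewrite nth_default// mul0r (horner_majorant_ge0 PQ).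
rewrite horner_coef (bigD1 (Ordinal nQ))//= lerDl sumr_ge0// => i _.
by rewrite mulr_ge0 ?(majorant_ge0 _ PQ)// exprn_ge0.
Qed.

(** This is P(x + h) - P(x) as a polynomial in h, the Taylor expansion without its constant term;
    composing polynomials then substitutes one expansion into the other. *)
Definition shift_poly x P := P \Po ('X + x%:P) - (P.[x])%:P.

Lemma shift_poly_comp x P Q :
  shift_poly x (Q \Po P) = shift_poly P.[x] Q \Po shift_poly x P.
Proof.
rewrite /shift_poly comp_polyB comp_polyC -!comp_polyA horner_comp.
by rewrite [('X + _) \Po (_ - _)]comp_polyD comp_polyX comp_polyC subrK.
Qed.

(** In the majorant sense, the expansion at [x] sends the disc of radius [s] into the disc of radius
    [t]; such radii chain along an orbit. *)
Definition expands_within P x s t :=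
  exists2 Q, majorant (shift_poly x P) Q & Q.[s] <= t.

Lemma expands_within_comp P Q x s t u : 0 <= s ->
  expands_within P x s t -> expands_within Q P.[x] t u ->
  expands_within (Q \Po P) x s u.
Proof.
move=> s0 [A PA As] [B QB Bt]; exists (B \Po A).
  by rewrite shift_poly_comp; exact: majorant_comp.
rewrite horner_comp; apply: le_trans Bt; apply: horner_le QB _ As.
exact: horner_majorant_ge0 PA s0.
Qed.

Lemma expands_withinX x s : expands_within 'X x s s.
Proof.
exists 'X; last by rewrite hornerX.
by rewrite /shift_poly comp_polyX hornerX addrK; exact: majorantX.
Qed.

Definition coef_norm P := \sum_(i < size P) `|P`_i|.

Lemma coef_norm_ge0 P : 0 <= coef_norm P.
Proof. exact: sumr_ge0. Qed.

(** The majorant has no constant term, so Q(s) = s Q1(s) with Q1 nondecreasing. Hence Q(s) <= s Q(1)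
    for s <= 1, and Q(1) is at most the sum of the |P_i| (1 + |x|)^i. *)
Lemma expands_within_linear P x s : 0 <= s <= 1 ->
  expands_within P x s (s * (coef_norm P * (1 + `|x|) ^+ (size P).-1)).
Proof.
move=> /andP[s0 s1].
pose A := \poly_(i < size P) `|P`_i|.
have PA : majorant P A.
  move=> i; rewrite coef_poly; case: ltnP => // /(nth_default 0) ->.
  by rewrite normr0.
pose B := A \Po ('X + `|x|%:P).
have PB : majorant (P \Po ('X + x%:P)) B.
  by apply: majorant_comp PA _; exact: majorantD majorantX (majorantC _).
pose Q := B - (B`_0)%:P.
have PQ : majorant (shift_poly x P) Q.
  move=> -[|i]; rewrite !coefB !coefC/= ?subr0//.
  by rewrite subrr -horner_coef0 horner_comp !hornerE subrr normr0.
exists Q => //.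
have Qs t : Q.[t] = t * (\poly_(i < size Q) Q`_i.+1).[t].
  have QE : Q = (\poly_(i < size Q) Q`_i.+1) * 'X.
    apply/polyP => -[|i]; rewrite coefMX/= ?coefB ?coefC ?subrr//.
    rewrite coef_poly coefB coefC/= subr0.
    case: ltnP => // /leqW /(nth_default 0).
    by rewrite coefB coefC/= subr0.
  by rewrite {1}QE hornerM hornerX mulrC.
have Qmaj : majorant (\poly_(i < size Q) Q`_i.+1) (\poly_(i < size Q) Q`_i.+1).
  move=> i; rewrite coef_poly; case: ltnP; rewrite ?normr0// => _.
  by rewrite ger0_norm// (majorant_ge0 _ PQ).
rewrite Qs ler_wpM2l//.
apply: (@le_trans _ _ (Q.[1])).
  by rewrite Qs mul1r (horner_le Qmaj).
apply: (@le_trans _ _ (B.[1])).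
  by rewrite hornerD hornerN hornerC gerBl (majorant_ge0 _ PB).
rewrite horner_comp !hornerE horner_poly mulr_suml; apply: ler_sum => i _.
rewrite ler_wpM2l//; apply: ler_weXn2l; first by rewrite lerDl.
by rewrite -ltnS (leq_trans (ltn_ord i))// leqSpred.
Qed.

Lemma derivn_comp_shift P x n :
  (P \Po ('X + x%:P))^`(n) = P^`(n) \Po ('X + x%:P).
Proof.
elim: n => [|n IHn]; first by rewrite !derivn0.
by rewrite !derivnS IHn deriv_comp derivD derivX derivC addr0 mulr1.
Qed.

Lemma horner_derivn P x n : P^`(n).[x] = (P \Po ('X + x%:P))`_n * n`!%:R.
Proof.
have -> : P^`(n).[x] = (P \Po ('X + x%:P))^`(n).[0].
  by rewrite derivn_comp_shift horner_comp !hornerE.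
by rewrite horner_coef0 coef_derivn addn0 ffactnn mulr_natr.
Qed.

(* Incomplete Bell polynomials in the derivatives of P: the coefficient of
   f^(k)(P x) in the n-th derivative of f \o P. *)
Fixpoint bell P (n k : nat) : {poly R} :=
  if n is n'.+1 then
    (bell P n' k)^`() + (if k is k'.+1 then P^`() * bell P n' k' else 0)
  else (k == 0)%:R.

Lemma bell_small P n k : (n < k)%N -> bell P n k = 0.
Proof.
elim: n k => [|n IHn] [|k]//= nk.
by rewrite !IHn// 1?ltnW// deriv0 mulr0 addr0.
Qed.

End Majorants.

(** * Factorials and geometric factors against the weights exp (a N^r) *)

Section Growth.
Variable R : realType.
Implicit Types (a b C r : R) (N k : nat).

Lemma fact_le_exp N : (N.+1`! <= N.+1 ^ N)%N.
Proof.
elim: N => // N IHN; rewrite factS expnS leq_mul2l/=.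
by apply: leq_trans IHN _; case: N => // N; rewrite leq_exp2r.
Qed.

Lemma linear_le_expR_powR a r C : 0 < a -> 0 < r ->
  exists N0, forall N, (N0 <= N)%N -> C * N.+1%:R <= expR (a * N%:R `^ r).
Proof.
move=> a0 r0.
(* The term of degree j + 1 of the exponential series is then at least of order N^2. *)
have [j jr] : exists j : nat, 2 <= j.+1%:R * r.
  exists (Num.trunc (2 / r)); rewrite -ler_pdivrMr//.
  by apply: ltW; rewrite Num.Theory.truncnS_gt.
pose b := a ^+ j.+1 / j.+1`!%:R.
have b0 : 0 < b by rewrite divr_gt0 ?exprn_gt0// ltr0n fact_gt0.
have [N0 N0b] : exists N0 : nat, `|C| * 2 / b <= N0%:R.
  exists (Num.trunc (`|C| * 2 / b)).+1.
  by apply: ltW; rewrite Num.Theory.truncnS_gt.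
exists N0.+1 => N NN0.
have N1 : 1 <= N%:R :> R by rewrite ler1n (leq_trans _ NN0).
have x0 : 0 <= a * N%:R `^ r by rewrite mulr_ge0 ?powR_ge0 ?ltW.
apply: le_trans (expR_ge1Dxn j x0).
have -> : (a * N%:R `^ r) ^+ j.+1 / j.+1`!%:R = b * N%:R `^ (j.+1%:R * r).
  rewrite exprMn -[X in _ * X / _]powR_mulrn ?powR_ge0// -powRrM (mulrC r) /b.
  by ring.
apply: (@le_trans _ _ (b * N%:R ^+ 2)); last first.
  apply: ler_wpDl => //; rewrite ler_pM2l//.
  by rewrite -(powR_mulrn 2 (ler0n _ N)) ler_powR.
apply: (@le_trans _ _ (`|C| * 2 * N%:R)).
  apply: (@le_trans _ _ (`|C| * N.+1%:R)); first by rewrite ler_wpM2r// ler_norm.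
  by rewrite -mulrA ler_wpM2l// -natr1; lra.
rewrite expr2 mulrA ler_wpM2r ?ler0n//.
rewrite [leRHS]mulrC -ler_pdivrMr//; apply: le_trans N0b _.
by rewrite ler_nat ltnW.
Qed.

(** Since (N + 1)! <= (N + 1)^N, the left side is at most (C (N + 1))^N. For large N the base is
    below exp (a N^(r - 1)), whose N-th power is exp (a N^r); [K] covers the finitely many other
    N. *)
Lemma fact_exp_le_expR_powR a r C : 0 < a -> 1 < r -> 0 <= C ->
  exists2 K, 0 <= K &
    forall N, N.+1`!%:R * C ^+ N <= K * expR (a * N%:R `^ r).
Proof.
move=> a0 r1 C0.
have r10 : 0 < r - 1 by rewrite subr_gt0.
have [N0 HN0] := linear_le_expR_powR C a0 r10.
pose K := 1 + \sum_(N < N0) N.+1`!%:R * C ^+ N.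
have K1 : 1 <= K.
  by rewrite lerDl sumr_ge0// => i _; rewrite mulr_ge0// exprn_ge0.
exists K; first exact: le_trans K1.
move=> N; have eN : 1 <= expR (a * N%:R `^ r).
  by rewrite -expR0 ler_expR mulr_ge0 ?powR_ge0 ?ltW.
have [NN0|NN0] := ltnP N N0.
  apply: (@le_trans _ _ K).
    rewrite /K (bigD1 (Ordinal NN0))//= addrCA lerDl addr_ge0// sumr_ge0// => i _.
    by rewrite mulr_ge0// exprn_ge0.
  by rewrite ler_peMr// (le_trans _ K1).
apply: (@le_trans _ _ (expR (a * N%:R `^ r))); last by rewrite ler_peMl// ?expR_ge0.
apply: (@le_trans _ _ ((C * N.+1%:R) ^+ N)).
  by rewrite exprMn mulrC ler_wpM2l ?exprn_ge0// -natrX ler_nat fact_le_exp.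
case: N NN0 eN => [|N] NN0 eN; first by rewrite expr0.
apply: (@le_trans _ _ (expR (a * N.+1%:R `^ (r - 1)) ^+ N.+1)).
  by rewrite lerXn2r ?nnegrE ?mulr_ge0 ?expR_ge0// HN0.
rewrite -expRM_natl ler_expR mulrCA ler_pM2l// mulr_powRB1 ?ler0n//.
by rewrite (lt_trans _ r1).
Qed.

(** One half of [a] absorbs the factorial and the geometric factor, the other half pays for the
    dilated exponent. *)
Lemma weight_absorb a r C k : 0 < a -> 1 < r -> 0 <= C ->
  exists b K, [/\ 0 < b, 0 <= K & forall N,
    N.+1`!%:R * C ^+ N * expR (b * (k * N.+1)%:R `^ r)
      <= K * expR (a * N%:R `^ r)].
Proof.
move=> a0 r1 C0.
have r0 : 0 < r by apply: lt_trans r1.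
have a20 : 0 < a / 2 by lra.
have [K K0 HK] := fact_exp_le_expR_powR a20 r1 C0.
(* From N + 1 <= 2 max(1, N); [k.+1] in place of [k] keeps [D] positive when k = 0. *)
pose D : R := (2 * k.+1)%:R `^ r.
have D0 : 0 < D by rewrite powR_gt0.
exists (a / 2 / D), (K * expR (a / 2)); split => [||N].
- by rewrite divr_gt0.
- by rewrite mulr_ge0 ?expR_ge0.
apply: le_trans (ler_wpM2r (expR_ge0 _) (HK N)) _.
rewrite -!mulrA ler_wpM2l// -!expRD ler_expR.
suff H : (k * N.+1)%:R `^ r <= D * (N%:R `^ r + 1).
  have : a / 2 / D * (k * N.+1)%:R `^ r <= a / 2 * (N%:R `^ r + 1).
    by rewrite -mulrA ler_pM2l// mulrC ler_pdivrMr// mulrC.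
  by rewrite !mulrA; move: (a / 2 / D * _) (N%:R `^ r) => X Y; lra.
apply: (@le_trans _ _ (D * Num.max 1 N%:R `^ r)).
  have M0 : 0 <= Num.max 1 N%:R :> R by rewrite le_max ler01.
  rewrite /D -powRM//; apply: ge0_ler_powR; rewrite ?nnegrE ?(ltW r0) ?mulr_ge0//.
  case: N {M0} => [|N]; first by rewrite max_l// mulr1 ler_nat; lia.
  by rewrite max_r ?ler1n// -natrM ler_nat; nia.
rewrite ler_pM2l//; case: N => [|N]; first by rewrite max_l// powR1 lerDr powR_ge0.
by rewrite max_r ?ler1n// lerDl.
Qed.

End Growth.

(** * Higher derivatives of compositions *)

Section ChainRule.
Variable R : realType.
Implicit Types (u v : R -> R) (P Q F : {poly R}) (x s : R).

Lemma derive1n_horner F n : derive1n n (horner F) = horner F^`(n).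
Proof.
by elim: n => [|n IHn]; rewrite ?derivn0// derive1nS IHn derivnS derivE.
Qed.

Lemma smooth_horner F : smooth (horner F).
Proof. by move=> n x; rewrite derive1n_horner; exact: derivable_horner. Qed.

Lemma is_derive_derive1 u x : derivable u x 1 -> is_derive x 1 u (derive1 u x).
Proof. by move=> du; apply: DeriveDef => //; rewrite derive1E. Qed.

Lemma is_derive_sum n (h : 'I_n -> R -> R) (dh : 'I_n -> R) x :
  (forall i, is_derive x 1 (h i) (dh i)) ->
  is_derive x 1 (fun y => \sum_(i < n) h i y) (\sum_(i < n) dh i).
Proof.
move=> hdh; have -> : (fun y => \sum_(i < n) h i y) = \sum_(i < n) h i.
  by apply/funext => y; rewrite fct_sumE.
exact: is_derive_sum.
Qed.

Lemma is_derive_bell u P n x : smooth u ->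
  is_derive x 1
    (fun y => \sum_(k < n.+1) derive1n k u P.[y] * (bell P n k).[y])
    (\sum_(k < n.+2) derive1n k u P.[x] * (bell P n.+1 k).[x]).
Proof.
move=> su.
have du (k : nat) (y : R) : is_derive y 1
    (fun y => derive1n k u P.[y] * (bell P n k).[y])
    (derive1n k.+1 u P.[y] * P^`().[y] * (bell P n k).[y]
     + derive1n k u P.[y] * (bell P n k)^`().[y]).
  have dk := is_derive_derive1 (su k P.[y]).
  have dP := is_derive_derive1 (@derivable_horner _ P y).
  have dB := is_derive_derive1 (@derivable_horner _ (bell P n k) y).
  have dc := is_derive1_comp dk dP.
  have := is_deriveM dc dB.
  rewrite -!derivE => dM; apply: is_derive_eq dM _.
  by rewrite /= /GRing.scale/=; ring.
apply: is_derive_eq (is_derive_sum (fun k : 'I_n.+1 => du k x)) _.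
rewrite big_split/= addrC [RHS]big_ord_recl/= addr0.
under [X in _ = _ + X]eq_bigr do rewrite hornerD mulrDr.
rewrite [X in _ = _ + X]big_split/= addrA; congr (_ + _).
  (* The added term k = n + 1 vanishes by [bell_small], which aligns both index ranges. *)
  transitivity (\sum_(k < n.+2) derive1n k u P.[x] * (bell P n k)^`().[x]).
    by rewrite [RHS]big_ord_recr/= bell_small// deriv0 horner0 mulr0 addr0.
  by rewrite big_ord_recl.
by apply: eq_bigr => k _; rewrite hornerM mulrA.
Qed.

Lemma derive1n_comp_horner u P n : smooth u ->
  derive1n n (u \o horner P)
    = fun x => \sum_(k < n.+1) derive1n k u P.[x] * (bell P n k).[x].
Proof.
move=> su; elim: n => [|n IHn]; apply/funext => x.
  by rewrite derive1n0 big_ord1 derive1n0/= hornerC mulr1.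
by rewrite derive1nS IHn derive1E; apply: derive_val; exact: is_derive_bell.
Qed.

Lemma smooth_comp_horner u P : smooth u -> smooth (u \o horner P).
Proof.
move=> su n x; rewrite derive1n_comp_horner//.
by have [] := is_derive_bell P n x su.
Qed.

(* The chain rule tested on the polynomial ('X - P x)^k / k!, all of whose
   derivatives at P x vanish except the k-th. *)
Lemma horner_bell P n k x :
  k`!%:R * (bell P n k).[x] = n`!%:R * (shift_poly x P ^+ k)`_n.
Proof.
pose F : {poly R} := ('X - (P.[x])%:P) ^+ k.
have Fj j : F^`(j).[P.[x]] = k`!%:R *+ (j == k).
  rewrite horner_derivn rmorphXn rmorphB/= comp_polyX comp_polyC addrK coefXn.
  by case: eqP => [->|_]; rewrite ?mul0r ?mul1r.
have := derive1n_comp_horner P n (@smooth_horner F).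
have -> : horner F \o horner P = horner (F \Po P).
  by apply/funext => y; rewrite /= horner_comp.
rewrite derive1n_horner => /(congr1 (fun g => g x))/=.
rewrite horner_derivn.
have -> : (F \Po P) \Po ('X + x%:P) = shift_poly x P ^+ k.
  rewrite rmorphXn/= rmorphXn/=; congr (_ ^+ _).
  by rewrite /shift_poly rmorphB/= comp_polyX comp_polyC comp_polyB comp_polyC.
rewrite mulrC => ->.
have [kn|nk] := ltnP k n.+1.
  rewrite (bigD1 (Ordinal kn))//= derive1n_horner Fj eqxx big1 ?addr0// => j jk.
  rewrite derive1n_horner Fj; case: eqP => [E|_]; last by rewrite mul0r.
  by move: jk; rewrite -val_eqE/= E eqxx.
rewrite bell_small// horner0 mulr0 big1// => j _.
rewrite derive1n_horner Fj; case: eqP => [E|_]; last by rewrite mul0r.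
by have := ltn_ord j; rewrite E ltnNge nk.
Qed.

(** Cauchy's estimate on the disc of radius [s]: by [horner_bell] the value is, up to n!/k!, the
    n-th coefficient of the k-th power of the expansion, which is at most s^(-n) Q(s)^k with Q(s) <=
    1. *)
Lemma horner_bell_le P n k x s : 0 < s -> expands_within P x s 1 ->
  `|(bell P n k).[x]| <= n`!%:R * s^-1 ^+ n.
Proof.
move=> s0 [Q PQ Qs].
have s0' := ltW s0.
have kgt0 : 0 < (k`!%:R : R) by rewrite ltr0n fact_gt0.
apply: (@le_trans _ _ (k`!%:R * `|(bell P n k).[x]|)).
  by rewrite ler_peMl// ler1n fact_gt0.
rewrite -(ger0_norm (ltW kgt0)) -normrM horner_bell normrM normr_nat.
rewrite ler_wpM2l// exprVn -[leRHS]mul1r ler_pdivlMr ?exprn_gt0//.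
apply: le_trans (coef_majorant_le n (majorantXn k PQ) s0') _.
by rewrite horner_exp exprn_ile1// (horner_majorant_ge0 PQ).
Qed.

End ChainRule.

(** * Weighted estimates for compositions with tame polynomials *)

Section CompositionEstimate.
Variable R : realType.
Implicit Types (f g : R -> R[i]) (P : {poly R}) (a b r x s : R).

Lemma normc_real x : normc (x%:C)%C = `|x|.
Proof. by rewrite /normc/= expr0n/= addr0 sqrtr_sqr. Qed.

Lemma normc_sum_le n (u v c : nat -> R) :
  normc (Complex (\sum_(k < n) u k * c k) (\sum_(k < n) v k * c k))
    <= \sum_(k < n) normc (Complex (u k) (v k)) * `|c k|.
Proof.
elim: n => [|n IHn]; first by rewrite !big_ord0 normc0.
rewrite !big_ord_recr [normc]lock/= -lock.
rewrite [X in normc X <= _](_ : _ =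
    Complex (\sum_(k < n) u k * c k) (\sum_(k < n) v k * c k)
    + Complex (u n) (v n) * (c n)%:C%C); last first.
  by apply/eqP; rewrite eq_complex/= !mulr0 subr0 add0r !eqxx.
apply: le_trans (le_normcD _ _) _.
by apply: lerD => //; rewrite normcM normc_real.
Qed.

Lemma normc_cderive_comp f P n x : csmooth f ->
  normc (cderive n (f \o horner P) x)
    <= \sum_(k < n.+1) normc (cderive k f P.[x]) * `|(bell P n k).[x]|.
Proof.
move=> [fr fi]; rewrite /cderive.
have := derive1n_comp_horner P n fr; rewrite /comp/= => ->.
have := derive1n_comp_horner P n fi; rewrite /comp/= => ->.
exact: (normc_sum_le n.+1
  (fun k => derive1n k (fun y => complex.Re (f y)) P.[x])
  (fun k => derive1n k (fun y => complex.Im (f y)) P.[x])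
  (fun k => (bell P n k).[x])).
Qed.

Lemma csmooth_comp f P : csmooth f -> csmooth (f \o horner P).
Proof.
move=> [fr fi]; split.
  exact: (@smooth_comp_horner _ _ P fr).
exact: (@smooth_comp_horner _ _ P fi).
Qed.

Definition gs_bound a r (M : R) f := forall x n q,
  (1 + `|x|) ^+ q * normc (cderive n f x) <= M * expR (a * (n + q)%:R `^ r).

(** Both bounds are in terms of [P.[x]], the point where the decay of f is available. [A] and [k]
    are parameters so that a whole family of polynomials can share them. *)
Definition tame (A : R) (k : nat) P := forall x,
  1 + `|x| <= A * (1 + `|P.[x]|) /\
  exists s, [/\ 0 < s, s^-1 <= A * (1 + `|P.[x]|) ^+ k
              & expands_within P x s 1].

Lemma tame_bell_le A k P n j x : tame A k P ->
  `|(bell P n j).[x]| <= n`!%:R * (A * (1 + `|P.[x]|) ^+ k) ^+ n.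
Proof.
move=> /(_ x)[_ [s [s0 sA Ps]]]; apply: le_trans (horner_bell_le n j s0 Ps) _.
rewrite ler_wpM2l// lerXn2r ?nnegrE ?invr_ge0 ?(ltW s0)//.
by apply: le_trans sA; rewrite invr_ge0 ltW.
Qed.

(** The constants are chosen before [P], which gives uniformity over a tame family. The factor [e]
    records a gain: e = 1 always qualifies, and polynomials with large values allow a small [e]. *)
Lemma gs_bound_comp A k a r : 0 < a -> 1 < r -> 0 <= A ->
  exists b K, [/\ 0 < b, 0 <= K &
    forall P (e M : R) f, csmooth f -> tame A k P -> 0 <= e ->
      (forall x, 1 <= e * (1 + `|P.[x]|)) ->
      gs_bound b r M f -> gs_bound a r (e * K * M) (f \o horner P)].
Proof.
move=> a0 r1 A0; have [b [K [b0 K0 HK]]] := weight_absorb k.+1 a0 r1 A0.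
exists b, K; split => // P e M f sf tP e0 Pe fM x n q.
have M0 : 0 <= M.
  have := fM 0 0 0; rewrite expr0 mul1r => /(le_trans (normc_ge0 _)).
  by rewrite pmulr_lge0 ?expR_gt0.
set Y := 1 + `|P.[x]|.
have Y1 : 1 <= Y by rewrite lerDl.
have Y0 : 0 <= Y by apply: le_trans Y1.
(* One extra power of [Y] is traded for [e]. Order and powers then sum to j + q + k n + 1 <= (k +
   1)(n + q + 1). *)
have term (j : 'I_n.+1) : Y ^+ (q + k * n) * normc (cderive j f P.[x])
    <= e * M * expR (b * (k.+1 * (n + q).+1)%:R `^ r).
  apply: (@le_trans _ _ (e * (Y ^+ (q + k * n).+1 * normc (cderive j f P.[x])))).
    rewrite exprS !mulrA -mulrA ler_peMl ?mulr_ge0 ?exprn_ge0 ?normc_ge0//.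
    exact: Pe.
  rewrite -mulrA ler_wpM2l//; apply: le_trans (fM _ _ _) _.
  rewrite ler_wpM2l// ler_expR ler_pM2l// ge0_ler_powR ?nnegrE//.
    by rewrite ltW// (lt_trans _ r1).
  by rewrite ler_nat; have := ltn_ord j; nia.
apply: (@le_trans _ _ ((A * Y) ^+ q * \sum_(j < n.+1)
    normc (cderive j f P.[x]) * (n`!%:R * (A * Y ^+ k) ^+ n))).
  apply: ler_pM; rewrite ?exprn_ge0 ?normc_ge0//.
    rewrite lerXn2r ?nnegrE ?mulr_ge0//.
    by have [] := tP x.
  apply: le_trans (normc_cderive_comp _ _ _ sf) _.
  apply: ler_sum => j _; rewrite ler_wpM2l ?normc_ge0//.
  exact: tame_bell_le.
apply: (@le_trans _ _ (\sum_(j < n.+1) A ^+ (n + q) * n`!%:R *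
    (e * M * expR (b * (k.+1 * (n + q).+1)%:R `^ r)))).
  rewrite mulr_sumr; apply: ler_sum => j _.
  have -> : (A * Y) ^+ q *
      (normc (cderive j f P.[x]) * (n`!%:R * (A * Y ^+ k) ^+ n))
    = A ^+ (n + q) * n`!%:R * (Y ^+ (q + k * n) * normc (cderive j f P.[x])).
    by rewrite !exprMn -exprM !exprD; ring.
  by rewrite ler_wpM2l// mulr_ge0// exprn_ge0.
rewrite sumr_const card_ord.
(* The number n + 1 of terms turns n! into (n + 1)!. *)
apply: (@le_trans _ _ (e * M * ((n + q).+1`!%:R * A ^+ (n + q) *
    expR (b * (k.+1 * (n + q).+1)%:R `^ r)))).
  rewrite -[leLHS]mulr_natl.
  set E := expR _; set AN := A ^+ _.
  have -> : n.+1%:R * (AN * n`!%:R * (e * M * E)) = e * M * (n.+1`!%:R * AN * E).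
    by rewrite factS natrM; ring.
  rewrite ler_wpM2l ?mulr_ge0// ler_wpM2r ?expR_ge0// ler_wpM2r ?exprn_ge0//.
  by rewrite ler_nat leq_fact// ltnS leq_addr.
by rewrite [e * K * M]mulrAC -[leRHS]mulrA ler_wpM2l ?mulr_ge0.
Qed.

End CompositionEstimate.

(** * Orbits of polynomials without fixed points *)

Section Dynamics.
Variable R : realType.
Implicit Types (P : {poly R}) (x y : R).

Lemma quadratic_growth P : (2 < size P)%N -> exists c T : R,
  [/\ 0 < c, 1 <= T &
    forall x, T <= 1 + `|x| -> c * (1 + `|x|) ^+ 2 <= 1 + `|P.[x]|].
Proof.
move=> sP.
pose a := `|lead_coef P|; pose B := coef_norm P.
have a0 : 0 < a.
  by rewrite normr_gt0 lead_coef_eq0 -size_poly_gt0 (ltn_trans _ sP).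
have B0 : 0 <= B := coef_norm_ge0 P.
have Ba0 : 0 <= 2 * B / a by rewrite divr_ge0 ?mulr_ge0// ltW.
(* Beyond the threshold |x| >= 1 and a |x| >= 2 B, so half of the leading term survives: |P x| >= (a
   / 2) |x|^2, and (1 + |x|)^2 <= 4 |x|^2. *)
exists (a / 8), (2 + 2 * B / a); split => [||x Tx].
- by rewrite divr_gt0.
- by move: (2 * B / a) Ba0 => ?; lra.

have x1 : 1 <= `|x| by move: (2 * B / a) Ba0 Tx => ?; lra.
have xB : 2 * B <= a * `|x|.
  rewrite [leRHS]mulrC -ler_pdivrMr//.
  by move: (2 * B / a) Ba0 Tx => ?; lra.
have [d Pd] : exists d, size P = d.+3.
  by exists (size P - 3)%N; rewrite -addn3 subnK.
have lower : a * `|x| ^+ d.+2 - B * `|x| ^+ d.+1 <= `|P.[x]|.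
  rewrite lerBlDr horner_coef Pd big_ord_recr/=.
  have le_sum : `|\sum_(i < d.+2) P`_i * x ^+ i| <= B * `|x| ^+ d.+1.
    apply: le_trans (ler_norm_sum _ _ _) _.
    apply: (@le_trans _ _ (\sum_(i < d.+2) `|P`_i| * `|x| ^+ d.+1)).
      apply: ler_sum => i _; rewrite normrM normrX ler_wpM2l//.
      by apply: ler_weXn2l => //; rewrite -ltnS ltn_ord.
    rewrite -mulr_suml ler_wpM2r ?exprn_ge0//.
    by rewrite /B /coef_norm Pd [leRHS]big_ord_recr/= lerDl.
  have -> : a * `|x| ^+ d.+2 = `|P`_d.+2 * x ^+ d.+2|.
    by rewrite normrM normrX /a lead_coefE Pd.
  have := lerB_normD (P`_d.+2 * x ^+ d.+2) (\sum_(i < d.+2) P`_i * x ^+ i).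
  by rewrite addrC; lra.
have xd : `|x| <= `|x| ^+ d.+1 by rewrite exprS ler_peMr// exprn_ege1.
have : a / 2 * `|x| * `|x| <= a * `|x| ^+ d.+2 - B * `|x| ^+ d.+1.
  rewrite (exprS _ d.+1) mulrA -mulrBl.
  by apply: ler_pM => //; [rewrite mulr_ge0//; lra|lra].
by rewrite expr2; nra.
Qed.

(** P x - x has constant sign [e] by the intermediate value theorem. It is bounded below by its
    minimum on a compact interval, and by 1 outside through quadratic growth. *)
Lemma displacement_gap P :
  (2 < size P)%N -> ~ (exists x, P.[x] = x) ->
  exists e d : R, [/\ `|e| = 1, 0 < d & forall x, d <= e * (P.[x] - x)].
Proof.
move=> sP nofix; have [c [T [c0 T1 growth]]] := quadratic_growth sP.
have nroot x : P.[x] - x != 0.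
  by apply/eqP => /eqP; rewrite subr_eq0 => /eqP Px; apply: nofix; exists x.
pose e : R := Num.sg (P.[0] - 0).
have e1 : `|e| = 1 by rewrite normr_sg nroot.
pose q : {poly R} := e *: (P - 'X).
have qE x : q.[x] = e * (P.[x] - x) by rewrite !hornerE.
have q0 : 0 < q.[0] by rewrite qE -normrEsg normr_gt0.
have qnroot x : q.[x] != 0.
  by rewrite qE mulf_neq0// -normr_gt0 e1.
have qpos x : 0 < q.[x].
  rewrite ltNge; apply/negP => qx.
  have [x0|x0] := leP x 0.
    have [|y _ /eqP qy] := @poly_ivt _ q x 0 x0; first by rewrite qx ltW.
    by have := qnroot y; rewrite qy eqxx.
  have [|y _ /eqP] := @poly_ivt _ (- q) 0 x (ltW x0).
    by rewrite !hornerN oppr_le0 oppr_ge0 qx ltW.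
  by rewrite hornerN => /eqP; rewrite oppr_eq0 (negPf (qnroot y)).
(* For |x| > M, c (1 + |x|) >= 2, hence 1 + |P x| >= 2 (1 + |x|). *)
pose M := T + 2 / c.
have M0 : 0 <= M by rewrite addr_ge0 ?divr_ge0//; lra.
have [z _ zmin] : exists2 z, z \in `[- M, M] &
    forall t, t \in `[- M, M] -> q.[z] <= q.[t].
  apply: EVT_min; first by lra.
  by apply: continuous_subspaceT => t; apply: continuous_horner.
exists e, (Num.min 1 q.[z]); split => //; first by rewrite lt_min ltr01 qpos.
move=> x; rewrite -qE; have [xM|Mx] := leP `|x| M.
  by rewrite ge_min zmin ?orbT// in_itv/= -ler_norml.
rewrite ge_min; apply/orP; left.
have -> : q.[x] = `|P.[x] - x|.
  by rewrite -[LHS]gtr0_norm// qE normrM e1 mul1r.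
have := growth x; have := lerB_dist P.[x] x.
have c2 : 2 <= c * (1 + `|x|).
  rewrite [leRHS]mulrC -ler_pdivrMr//; have : T + 2 / c < `|x| by [].
  by move: (2 / c) => ?; lra.
have Tx : T <= 1 + `|x|.
  have : 0 <= 2 / c by rewrite divr_ge0// ltW.
  by have : T + 2 / c < `|x| by []; lra.
by move=> H1 /(_ Tx); rewrite expr2; nra.
Qed.

End Dynamics.

(** * Uniform tameness of the iterates *)

Section TameIterates.
Variable R : realType.
Implicit Types (P : {poly R}) (x y : R).

(** Each new factor is composed on the inside, so that inductions peel off the first step of the
    orbit. *)
Definition poly_iter P m : {poly R} := iter m (fun Q => Q \Po P) 'X.

Lemma horner_poly_iterS P m x : (poly_iter P m.+1).[x] = (poly_iter P m).[P.[x]].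
Proof. by rewrite /poly_iter iterS horner_comp. Qed.

Definition expansion_rate P x : R :=
  (1 + coef_norm P) * (1 + `|x|) ^+ (size P).-1.

Lemma expansion_rate_ge1 P x : 1 <= expansion_rate P x.
Proof.
have [u v] : 1 <= 1 + coef_norm P /\ 1 <= (1 + `|x|) ^+ (size P).-1.
  by split; [rewrite lerDl coef_norm_ge0|rewrite exprn_ege1// lerDl].
exact: mulr_ege1.
Qed.

Lemma expands_within_rate P x s : 0 <= s <= 1 ->
  expands_within P x s (s * expansion_rate P x).
Proof.
move=> s01; have [Q PQ Qs] := expands_within_linear P x s01.
exists Q => //; apply: le_trans Qs _; have /andP[s0 _] := s01.
rewrite ler_wpM2l// ler_wpM2r ?exprn_ge0 ?addr_ge0//.
by rewrite lerDr.
Qed.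

Lemma tame_poly P : (2 < size P)%N -> exists A k, 0 <= A /\ tame A k P.
Proof.
move=> sP; have [c [T [c0 T1 growth]]] := quadratic_growth sP.
(* The summand 1/c serves where growth holds, since c t <= c t^2 <= Y, and [T] serves where t <
   T. *)
pose A : R := c^-1 + T; pose d := (size P).-1; pose K : R := 1 + coef_norm P.
have ci0 : 0 < c^-1 by rewrite invr_gt0.
have A0 : 0 <= A by rewrite addr_ge0 ?(ltW ci0)// (le_trans _ T1).
have K0 : 0 <= K by rewrite addr_ge0// coef_norm_ge0.
have AY x : 1 + `|x| <= A * (1 + `|P.[x]|).
  set t := 1 + `|x|; set Y := 1 + `|P.[x]|.
  have Y1 : 1 <= Y by rewrite lerDl.
  have t1 : 1 <= t by rewrite lerDl.
  rewrite /A mulrDl; have [Tt|tT] := leP T t; last first.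
    apply: ler_wpDl; first by apply: mulr_ge0; [exact: ltW|exact: le_trans Y1].
    by apply: (le_trans (ltW tT)); rewrite ler_peMr// (le_trans _ T1).
  apply: ler_wpDr; first by apply: mulr_ge0; [exact: le_trans T1|exact: le_trans Y1].
  rewrite mulrC ler_pdivlMr// mulrC; apply: le_trans (growth x Tt).
  by rewrite expr2 ler_pM2l// ler_peMr// (le_trans _ t1).
have AKA : A <= A + K * A ^+ d by rewrite lerDl mulr_ge0// exprn_ge0.
exists (A + K * A ^+ d), d; split => [|x]; first exact: le_trans AKA.
have Y0 : 0 <= 1 + `|P.[x]| by rewrite addr_ge0.
split; first by apply: le_trans (AY x) _; rewrite ler_wpM2r.
have L1 := expansion_rate_ge1 P x.
have L0 : 0 < expansion_rate P x by apply: lt_le_trans L1.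
exists (expansion_rate P x)^-1; split.
- by rewrite invr_gt0.
- rewrite invrK /expansion_rate -/d -/K.
  apply: (@le_trans _ _ (K * (A ^+ d * (1 + `|P.[x]|) ^+ d))).
    rewrite ler_wpM2l// -exprMn.
    by rewrite lerXn2r ?AY ?nnegrE ?(mulr_ge0 A0 Y0) ?(addr_ge0 ler01).
  by rewrite mulrA ler_wpM2r ?exprn_ge0// lerDr.
- rewrite -[X in expands_within _ _ _ X](mulVf (lt0r_neq0 L0)).
  by apply: expands_within_rate; rewrite invr_ge0 ltW//= invf_le1.
Qed.

(* A weight W with expansion_rate(x) W(x) <= W(P x), so that the expansion rates
   telescope along orbits.  Far out, a high power of 1 + |x| works since P
   grows quadratically; on the remaining compact set the factor exp (b * _)
   gains a fixed amount at each step because the orbit moves by at least d in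
   the direction e. *)
Lemma expansion_weight P (e d : R) : (2 < size P)%N -> `|e| = 1 -> 0 < d ->
    (forall x, d <= e * (P.[x] - x)) ->
  exists (W : R -> R) (A : R) (k : nat), [/\ 1 <= A,
    forall x, expansion_rate P x * W x <= W P.[x],
    forall x, (1 + `|x|) ^+ k.+1 <= A * W x
    & forall x, W x <= A * (1 + `|x|) ^+ k.+1].
Proof.
move=> sP e1 d0 gap; have [c [T0 [c0 T01 growth]]] := quadratic_growth sP.
pose j := (size P).-1; pose K : R := 1 + coef_norm P.
have K1 : 1 <= K by rewrite lerDl coef_norm_ge0.
(* Beyond [T] one has c^2 t >= 1, so Y^2 >= c^2 t^4 >= t^3, and also t >= K. *)
pose T : R := T0 + (c ^+ 2)^-1 + K.
have c20 : 0 < (c ^+ 2)^-1 by rewrite invr_gt0 exprn_gt0.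
have [TT0 TK Tc] : [/\ T0 <= T, K <= T & (c ^+ 2)^-1 <= T].
  rewrite /T; clear T; clearbody K; move: (c ^+ 2)^-1 c20 => z z0; split; lra.
have T1 : 1 <= T by apply: le_trans TT0.
(* With this exponent, Y^(k + 1) >= t^(3 (j + 1)) = t^(j + 1) t^(k + 1) >= K t^j t^(k + 1). *)
have [k kj] : exists k, k.+1 = (2 * j.+1)%N.
  by exists (j.*2).+1; rewrite -mul2n mulnS.
pose D : R := K * T ^+ j * T ^+ k.+1.
have [K0 T0'] : 0 <= K /\ 0 <= T by rewrite !(le_trans ler01).
have D0 : 0 <= D by rewrite mulr_ge0 ?exprn_ge0// mulr_ge0// exprn_ge0.
(* [D] bounds the required gain while t < T, and a move by [d] gains exp (b d) = exp D >= D. *)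
pose b : R := D / d; have b0 : 0 <= b by rewrite divr_ge0// ltW.
(* Clipping keeps the exponential factor between positive constants; the margin [d] at the top
   ensures that a step starting in [-T, T] keeps its full gain. *)
pose clip (y : R) : R := Num.max (- T) (Num.min y (T + d)).
have clip_homo : {homo clip : y z / y <= z}.
  move=> y z yz; rewrite /clip !(ge_max, le_max) lexx/=; apply/orP; right.
  by rewrite le_min !ge_min yz/= lexx orbT.
have clip_ge y : - T <= clip y by rewrite le_max lexx.
have clip_le y : clip y <= T + d.
  by rewrite ge_max ge_min lexx orbT andbT; lra.
pose A : R := expR (b * (T + d)).
exists (fun x => (1 + `|x|) ^+ k.+1 * expR (b * clip (e * x))), A, k.
have step x : e * x + d <= e * P.[x] by have := gap x; lra.
split.
- by rewrite -expR0 ler_expR mulr_ge0//; lra.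
- move=> x; rewrite /expansion_rate -/j -/K.
  set t := 1 + `|x|; set Y := 1 + `|P.[x]|.
  have Y1 : 1 <= Y by rewrite lerDl.
  have t1 : 1 <= t by rewrite lerDl.
  have [t0 Y0] : 0 <= t /\ 0 <= Y by split; lra.
  have KJ : 0 <= K * t ^+ j by rewrite mulr_ge0 ?exprn_ge0.
  have KJk : 0 <= K * t ^+ j * t ^+ k.+1 by rewrite mulr_ge0// exprn_ge0.
  rewrite mulrA; have [Tt|tT] := leP T t.
    apply: ler_pM; [by []|exact: expR_ge0| |]; last first.
      by rewrite ler_expR ler_wpM2l// clip_homo// (le_trans _ (step x))// lerDl ltW.
    have Yt : t ^+ 3 <= Y ^+ 2.
      have cY : c * t ^+ 2 <= Y by apply: growth; exact: le_trans Tt.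
      apply: (@le_trans _ _ ((c * t ^+ 2) ^+ 2)); last first.
        by rewrite lerXn2r ?nnegrE// mulr_ge0 ?exprn_ge0// ltW.
      have ct : 1 <= c ^+ 2 * t.
        rewrite mulrC -ler_pdivrMr ?exprn_gt0// mul1r.
        exact: le_trans Tt.
      rewrite exprMn -exprM (exprS t 3) mulrA ler_peMl ?exprn_ge0//.
    rewrite kj [leRHS]exprM.
    apply: (@le_trans _ _ ((t ^+ 3) ^+ j.+1)); last first.
      by rewrite lerXn2r ?nnegrE ?exprn_ge0.
    rewrite [t ^+ 3]exprS exprMn -exprM ler_wpM2r ?exprn_ge0//.
    by rewrite [leRHS]exprS ler_wpM2r ?exprn_ge0// (le_trans TK).
  apply: (@le_trans _ _ (D * expR (b * clip (e * x)))).
    rewrite ler_wpM2r ?expR_ge0// /D; apply: ler_pM.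
    + by [].
    + by rewrite exprn_ge0.
    + by rewrite ler_wpM2l ?lerXn2r ?nnegrE//; lra.
    + by rewrite lerXn2r ?nnegrE//; lra.
  apply: (@le_trans _ _ (expR (b * clip (e * P.[x])))); last first.
    by rewrite ler_peMl ?expR_ge0// exprn_ege1.
  apply: (@le_trans _ _ (expR (b * d) * expR (b * clip (e * x)))).
    rewrite ler_wpM2r ?expR_ge0// divfK ?gt_eqF//.
    by apply: le_trans (expR_ge1Dx D); rewrite lerDr.
  rewrite -expRD ler_expR -mulrDr ler_wpM2l//.
  have exT : `|e * x| <= T.
    by rewrite normrM e1 mul1r; move: tT; rewrite /t; lra.
  have /andP[exT1 exT2] : - T <= e * x <= T by rewrite -ler_norml.
  have -> : clip (e * x) = e * x.
    by rewrite /clip min_l ?max_r//; lra.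
  apply: le_trans (clip_homo _ _ (step x)).
  rewrite /clip min_l; last by lra.
  by rewrite le_max addrC lexx orbT.
- move=> x; rewrite mulrCA ler_peMr ?exprn_ge0 ?addr_ge0//.
  rewrite -expRD -mulrDr -expR0 ler_expR mulr_ge0//.
  by have := clip_ge (e * x); lra.
- move=> x; rewrite mulrC ler_wpM2r ?exprn_ge0 ?addr_ge0//.
  by rewrite ler_expR ler_wpM2l.
Qed.

Lemma tame_poly_iter P (e d : R) : (2 < size P)%N -> `|e| = 1 -> 0 < d ->
    (forall x, d <= e * (P.[x] - x)) ->
  exists A k, 0 <= A /\ forall m, tame A k (poly_iter P m).
Proof.
move=> sP e1 d0 gap.
have [W [A [k [A1 Wstep Wge Wle]]]] := expansion_weight sP e1 d0 gap.
have A0 : 0 <= A by apply: le_trans A1.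
have W0 x : 0 < W x.
  have : 0 < A * W x.
    by apply: lt_le_trans (Wge x); rewrite exprn_gt0// ltr_pwDl.
  by rewrite pmulr_rgt0// (lt_le_trans _ A1).
(* The radius for m + 1 steps is the one for m steps from P x divided by the expansion rate at x; by
   [Wstep] the bounds on the inverse radii telescope. *)
have Wratio m x : exists s, [/\ 0 < s, s <= 1,
    s^-1 <= W (poly_iter P m).[x] / W x & expands_within (poly_iter P m) x s 1].
  elim: m x => [|m IHm] x.
    exists 1; rewrite invr1 hornerX divff ?gt_eqF//; split => //.
    exact: expands_withinX.
  have [s [s0 s1 sW ex]] := IHm P.[x].
  have L1 := expansion_rate_ge1 P x.
  have L0 : 0 < expansion_rate P x by apply: lt_le_trans L1.
  exists (s / expansion_rate P x).
  have sL1 : s / expansion_rate P x <= 1.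
    by rewrite ler_pdivrMr// mul1r (le_trans s1).
  split => //; first by rewrite divr_gt0.
    rewrite invfM invrK mulrC; rewrite horner_poly_iterS.
    apply: (@le_trans _ _
        (expansion_rate P x * (W (poly_iter P m).[P.[x]] / W P.[x]))).
      by rewrite ler_pM2l.
    rewrite mulrCA ler_pM2l// ler_pdivrMr// mulrC ler_pdivlMr//.
  rewrite /poly_iter iterS; apply: expands_within_comp ex.
    by rewrite divr_ge0// ltW.
  rewrite -[X in expands_within _ _ _ X](divfK (lt0r_neq0 L0)).
  by apply: expands_within_rate; rewrite sL1 andbT divr_ge0// ltW.
(* One factor [A] bounds W y above by a power of 1 + |y|, the other bounds W x below. *)
exists (A ^+ 2), k.+1; split; first by rewrite exprn_ge0.
move=> m x; set y := (poly_iter P m).[x].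
have Y0 : 0 <= 1 + `|y| by rewrite addr_ge0.
have [s [s0 s1 sW ex]] := Wratio m x.
have WW : W x <= W y.
  rewrite -[leLHS]mul1r -ler_pdivlMr//; apply: le_trans sW.
  by rewrite invf_ge1.
split.
  have A2 : A <= A ^+ 2 by rewrite expr2 ler_peMr.
  rewrite -(@ler_pXn2r _ k.+1)// ?nnegrE ?addr_ge0 ?mulr_ge0 ?exprn_ge0//.
  apply: le_trans (Wge x) _; rewrite exprMn.
  apply: (@le_trans _ _ (A ^+ 2 * (1 + `|y|) ^+ k.+1)).
    rewrite expr2 -mulrA ler_wpM2l//; exact: le_trans WW (Wle y).
  rewrite ler_wpM2r ?exprn_ge0// -exprM; apply: ler_weXn2l => //.
  by rewrite mulnS leq_addr.
exists s; split => //; apply: le_trans sW _.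
rewrite ler_pdivrMr//; apply: le_trans (Wle y) _.
set Yk := _ ^+ k.+1.
have -> : A ^+ 2 * Yk * W x = A * Yk * (A * W x) by ring.
rewrite ler_peMr ?mulr_ge0 ?exprn_ge0//.
by apply: le_trans (Wge x); rewrite exprn_ege1// lerDl.
Qed.

(** The drift gives m d <= |x| + |P_m x|, and tameness bounds |x| by the endpoint, so the estimate
    is uniform in x. *)
Lemma poly_iter_escape P (e d A : R) k : `|e| = 1 -> 0 < d -> 0 <= A ->
    (forall x, d <= e * (P.[x] - x)) ->
    (forall m, tame A k (poly_iter P m)) ->
  forall m x, (0 < m)%N ->
    1 <= (1 + A) / d / m%:R * (1 + `|(poly_iter P m).[x]|).
Proof.
move=> e1 d0 A0 gap tP m x m0.
have drift y : e * y + m%:R * d <= e * (poly_iter P m).[y].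
  elim: m y {m0} => [|m IHm] y; first by rewrite mul0r addr0 hornerX.
  rewrite horner_poly_iterS -natr1; apply: le_trans (IHm _).
  by have := gap y; lra.
have m0' : 0 < m%:R :> R by rewrite ltr0n.
have [xA _] := tP m x.
set y := (poly_iter P m).[x] in xA *.
have ler_e z : e * z <= `|z|.
  by apply: le_trans (ler_norm _) _; rewrite normrM e1 mul1r.
have : m%:R * d <= (1 + A) * (1 + `|y|).
  have := drift x; rewrite -/y; have := ler_e y; have := ler_e (- x).
  by rewrite normrN mulrN; lra.
have -> : (1 + A) / d / m%:R * (1 + `|y|) = (1 + A) * (1 + `|y|) / (m%:R * d).
  by field; rewrite !gt_eqF.
by rewrite ler_pdivlMr ?mulr_gt0// mul1r.
Qed.

End TameIterates.

(** * The Young conjugate of the weight *)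

Section YoungConjugate.
Variables (R : realType) (p : R).
Hypothesis p1 : 1 < p.

Let p0 : 0 < p := lt_trans ltr01 p1.
Let p10 : 0 < p - 1. Proof. by rewrite subr_gt0. Qed.

Definition conj_exp : R := p / (p - 1).

Lemma conj_exp_gt1 : 1 < conj_exp.
Proof. by rewrite /conj_exp ltr_pdivlMr// mul1r gtrBl. Qed.

Lemma weight_phi_powR t : 0 <= t -> weight_phi (log_power_weight p) t = t `^ p.
Proof.
rewrite /weight_phi /log_power_weight => t0.
have [|t1] := leP (expR t) 1; last by rewrite expRK.
rewrite expR_le1 => t0'.
have -> : t = 0 by apply/eqP; rewrite eq_le t0 t0'.
by rewrite powR0// gt_eqF.
Qed.

Let S := [set u - u `^ p | u in [set u : R | 0 <= u]].

Let S_le1 v : S v -> v <= 1.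
Proof.
move=> [u /= u0 <-]; have [u1|u1] := leP u 1.
  by have := powR_ge0 u p; lra.
by have := le1r_powR (ltW u1) (ltW p1); lra.
Qed.

Let S_has_sup : has_sup S.
Proof.
split; last by exists 1 => v /S_le1.
by exists (0 - 0 `^ p), 0 => /=.
Qed.

(** This is the Young conjugate at 1; scaling makes its value at s equal to this constant times
    s^r. *)
Definition young_const := sup S.

Lemma young_const_gt0 : 0 < young_const.
Proof.
apply: (@lt_le_trans _ _ (2^-1 - 2^-1 `^ p)).
  rewrite subr_gt0 -[ltRHS]powRr1 ?invr_ge0//.
  have h0 : 0 < 2^-1 :> R by rewrite invr_gt0.
  rewrite !/powR !gt_eqF// ltr_expR.
  have : ln (2^-1) < 0 :> R by rewrite ln_lt0// h0 invf_lt1// ltr1n.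
  by move=> l0; rewrite ltr_nM2r.
apply: (sup_upper_bound S_has_sup).
by exists 2^-1 => //=; rewrite invr_ge0.
Qed.

Lemma young_conjugate_log_power s : 0 <= s ->
  young_conjugate (weight_phi (log_power_weight p)) s
    = (young_const * s `^ conj_exp)%:E.
Proof.
move=> s0; have r1 := conj_exp_gt1.
have c0 := young_const_gt0.
have p_neq0 : p != 0 by rewrite gt_eqF.
have p1_neq0 : p - 1 != 0 by rewrite gt_eqF.
move: s0; rewrite le_eqVlt => /predU1P[<-|s0].
  rewrite powR0 ?mulr0; last by rewrite gt_eqF// (lt_trans ltr01).
  apply/eqP; rewrite eq_le; apply/andP; split.
    apply: ge_ereal_sup => _ [t /= t0 <-].
    by rewrite lee_fin weight_phi_powR// mul0r sub0r oppr_le0 powR_ge0.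
  apply: ereal_sup_ubound; exists 0 => //=.
  by rewrite weight_phi_powR// powR0// mul0r subr0.
set d := s `^ (p - 1)^-1.
have d0 : 0 < d by rewrite powR_gt0.
have sr0 : 0 < s `^ conj_exp by rewrite powR_gt0.
(* With t = s^(1/(p-1)) u both s t and t^p pick up the factor s^(p/(p-1)). *)
have scale u : 0 <= u ->
    s * (d * u) - weight_phi (log_power_weight p) (d * u)
      = s `^ conj_exp * (u - u `^ p).
  have dge0 := ltW d0; move=> u0; rewrite weight_phi_powR ?mulr_ge0// powRM//.
  have -> : d `^ p = s `^ conj_exp by rewrite -powRrM mulrC.
  have -> : s * (d * u) = s `^ conj_exp * u.
    rewrite mulrA; congr (_ * _); rewrite -{1}(powRr1 (ltW s0)) -powRD.
      by congr (_ `^ _); rewrite /conj_exp; field.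
    by rewrite (gt_eqF s0) implybT.
  by rewrite mulrBr.
apply/eqP; rewrite eq_le; apply/andP; split.
  apply: ge_ereal_sup => _ [t /= t0 <-].
  have -> : t = d * (t / d) by rewrite mulrC divfK// gt_eqF.
  have td0 : 0 <= t / d by rewrite divr_ge0// ltW.
  rewrite lee_fin scale// mulrC ler_pM2r//; apply: (sup_upper_bound S_has_sup).
  by exists (t / d).
rewrite mulrC; set E := young_conjugate _ _.
have E_ge u : 0 <= u -> ((s `^ conj_exp * (u - u `^ p))%:E <= E)%E.
  move=> u0; apply: ereal_sup_ubound; exists (d * u); last by rewrite scale.
  by rewrite /= mulr_ge0// ltW.
case: E E_ge => [x| |] E_ge; [|by rewrite leey|by have := E_ge 0 (lexx _)].
rewrite lee_fin mulrC -ler_pdivlMr//; apply: ge_sup; first by case: S_has_sup.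
by move=> _ [u /= u0 <-]; rewrite ler_pdivlMr// mulrC -lee_fin E_ge.
Qed.

(** The coefficient of N^r in lambda phi*(N / lambda); as lambda varies it takes every positive
    value, because r > 1. *)
Definition gs_rate (lambda : R) : R :=
  young_const * lambda^-1 `^ (conj_exp - 1).

Lemma gs_rate_gt0 lambda : 0 < lambda -> 0 < gs_rate lambda.
Proof.
by move=> l0; rewrite /gs_rate mulr_gt0 ?young_const_gt0// powR_gt0// invr_gt0.
Qed.

Lemma gs_rate_surj b : 0 < b -> exists2 lambda, 0 < lambda & gs_rate lambda = b.
Proof.
move=> b0; have c0 := young_const_gt0.
have bc0 : 0 < b / young_const by rewrite divr_gt0.
exists ((b / young_const) `^ (conj_exp - 1)^-1)^-1.
  by rewrite invr_gt0 powR_gt0//.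
rewrite /gs_rate invrK -powRrM mulVf ?powRr1 ?(ltW bc0)//.
  by rewrite mulrC divfK// gt_eqF.
by rewrite subr_eq0 gt_eqF// conj_exp_gt1.
Qed.

Lemma gs_termE lambda f x n q : 0 < lambda ->
  gs_term (log_power_weight p) lambda f x n q
    = ((1 + `|x|) ^+ q * normc (cderive n f x)
        * expR (- (gs_rate lambda * (n + q)%:R `^ conj_exp)))%:E.
Proof.
move=> l0; rewrite /gs_term young_conjugate_log_power; last first.
  by rewrite divr_ge0// ltW.
have li0 : 0 <= lambda^-1 by rewrite invr_ge0 ltW.
have -> : gs_rate lambda * (n + q)%:R `^ conj_exp
    = lambda * (young_const * ((n + q)%:R / lambda) `^ conj_exp).
  rewrite powRM// /gs_rate powRB; last first.
    by rewrite [lambda^-1 == 0]gt_eqF ?invr_gt0// implybT.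
  rewrite powRr1// invrK; move: (_ `^ _) (lambda^-1 `^ _) => X Y; ring.
by rewrite /= EFinM.
Qed.

Lemma gs_seminorm_leP lambda f M : 0 < lambda ->
  (gs_seminorm (log_power_weight p) lambda f <= M%:E)%E <->
  gs_bound (gs_rate lambda) conj_exp M f.
Proof.
move=> l0; split => [fM x n q|fM].
  have := le_trans (gs_term_le _ _ _ x n q) fM.
  by rewrite gs_termE// lee_fin expRN ler_pdivrMr ?expR_gt0.
apply: ge_ereal_sup => _ [x [n [q ->]]].
by rewrite gs_termE// lee_fin expRN ler_pdivrMr ?expR_gt0.
Qed.

End YoungConjugate.

(** * Composition operators without fixed points *)

Section CompositionOperator.
Variables (R : realType) (p : R).
Hypothesis p1 : 1 < p.
Let om := log_power_weight p.
Implicit Types (f g h : gelfand_shilov om) (P : {poly R}).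

Lemma gs_seminorm_comp (lambda A : R) k : 0 < lambda -> 0 <= A ->
  exists mu K : R, [/\ 0 < mu, 0 <= K &
    forall P (e M : R) (f : R -> R[i]), csmooth f -> tame A k P -> 0 <= e ->
      (forall x, 1 <= e * (1 + `|P.[x]|)) ->
      (gs_seminorm om mu f <= M%:E)%E ->
      (gs_seminorm om lambda (f \o horner P) <= (e * K * M)%:E)%E].
Proof.
move=> l0 A0.
have [b [K [b0 K0 HK]]] :=
  gs_bound_comp k (gs_rate_gt0 p1 l0) (conj_exp_gt1 p1) A0.
have [mu mu0 muE] := gs_rate_surj p1 b0.
exists mu, K; split => // P e M f sf tP e0 Pe /(gs_seminorm_leP p1 _ _ mu0) fM.
by apply/(gs_seminorm_leP p1 _ _ l0)/HK => //; rewrite -muE.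
Qed.

Lemma gs_seminorm_fin (lambda : R) f : 0 < lambda ->
  exists M : R, (gs_seminorm om lambda f <= M%:E)%E.
Proof.
move=> l0; have /gs_predP[_ /(_ _ l0)] := valP f.
have := gs_seminorm_ge0 om lambda (gs_val f).
by case: gs_seminorm => // M _ _; exists M.
Qed.

Lemma gs_pred_comp A k P f : 0 <= A -> tame A k P ->
  gs_val f \o horner P \in gs_pred om.
Proof.
move=> A0 tP; apply/gs_predP; split; first exact: csmooth_comp (gs_csmooth f).
move=> l l0; have [mu [K [mu0 K0 HK]]] := gs_seminorm_comp k l0 A0.
have [M fM] := gs_seminorm_fin f mu0.
have P1 x : 1 <= 1 * (1 + `|P.[x]|) by rewrite mul1r lerDl.
apply: le_lt_trans (HK _ _ _ _ (gs_csmooth f) tP ler01 P1 fM) _.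
exact: ltry.
Qed.

Variable psi : {poly R}.
Hypothesis hpsi : (2 < size psi)%N.
Let T : gelfand_shilov om -> gelfand_shilov om :=
  composition_operator (fun x : R => psi.[x]).

(** Tameness of [psi] keeps f \o psi in the space, so the default value in [composition_operator] is
    never taken. *)
Lemma gs_val_composition f : gs_val (T f) = gs_val f \o horner psi.
Proof.
have [A [k [A0 tP]]] := tame_poly hpsi.
by rewrite /T /composition_operator (val_insubd 0) ifT// (gs_pred_comp f A0 tP).
Qed.

Lemma gs_val_iter m f : gs_val (iter m T f) = gs_val f \o horner (poly_iter psi m).
Proof.
elim: m => [|m IHm]; first by apply/funext => x /=; rewrite hornerX.
rewrite iterS gs_val_composition IHm; apply/funext => x /=.
by rewrite horner_poly_iterS.
Qed.

Lemma iter_compositionB m f g : iter m T (f - g) = iter m T f - iter m T g.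
Proof.
apply: val_inj; rewrite /= gs_val_iter.
by rewrite -[RHS]/(gs_val _ - gs_val _) !gs_val_iter.
Qed.

Section NoFixedPoints.
Hypothesis nofix : ~ exists x : R, psi.[x] = x.

(** Uniform tameness gives a bound independent of m, and escape supplies e of order 1/m. Power
    boundedness uses K / m <= K, mean ergodicity the decay. *)
Lemma gs_seminorm_iter_le (lambda : R) : 0 < lambda ->
  exists mu K : R, [/\ 0 < mu, 0 <= K & forall m f (M : R), (0 < m)%N ->
    (gs_seminorm om mu f <= M%:E)%E ->
    (gs_seminorm om lambda (iter m T f) <= (K / m%:R * M)%:E)%E].
Proof.
move=> l0; have [e [d [e1 d0 gap]]] := displacement_gap hpsi nofix.
have [A [k [A0 tP]]] := tame_poly_iter hpsi e1 d0 gap.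
have [mu [K [mu0 K0 HK]]] := gs_seminorm_comp k l0 A0.
have Ad0 : 0 <= (1 + A) / d by rewrite divr_ge0 ?addr_ge0// ltW.
exists mu, ((1 + A) / d * K); split => //; first by rewrite mulr_ge0.
move=> m f M m0 fM; rewrite gs_val_iter [X in X * M]mulrAC.
apply: HK (gs_csmooth f) (tP m) _ _ fM; first by rewrite divr_ge0.
by move=> x; exact: poly_iter_escape gap tP m x m0.
Qed.

Lemma power_bounded_no_fixed_point : power_bounded T.
Proof.
move=> f E [s [e [s0 e0 sE]]].
(* By linearity of the iterates, equicontinuity at [f] reduces to 0. *)
suff [t [e' [t0 e'0 H]]] : exists t e', [/\ all (fun lambda => 0 < lambda) t,
    0 < e' &
    forall h, (forall mu, mu \in t -> (gs_seminorm om mu h < e'%:E)%E) ->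
    forall m, (0 < m)%N -> forall lambda, lambda \in s ->
      (gs_seminorm om lambda (iter m T h) < e%:E)%E].
  have : nbhs f (xsection (gs_basic_entourage t e') f).
    by apply: nbhs_entourage; exists t, e'; split.
  apply: filterS => g; rewrite /xsection/= inE => fg m m0; apply: sE => lambda ls.
  by have := H (f - g) fg m m0 lambda ls; rewrite iter_compositionB.
elim: s s0 {sE} => [_|l s IHs /= /andP[l0 /IHs[t [e1 [t0 e10 H]]]]].
  by exists [::], 1.
have [mu [K [mu0 K0 HK]]] := gs_seminorm_iter_le l0.
(* [K + 1] is positive even if K = 0 and makes the final inequality strict. *)
exists (mu :: t), (Num.min e1 (e / (K + 1))).
have K10 : 0 < K + 1 by rewrite ltr_wpDl.
split; rewrite /= ?mu0 ?lt_min ?e10 ?divr_gt0//.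
move=> h hlt m m0 lambda; rewrite inE => /predU1P[->|ls].
  have : (gs_seminorm om mu h <= (e / (K + 1))%:E)%E.
    apply: ltW; apply: lt_le_trans (hlt mu _) _; first by rewrite inE eqxx.
    by rewrite lee_fin ge_min lexx orbT.
  move=> /(HK _ _ _ m0) /le_lt_trans; apply; rewrite lte_fin.
  apply: (@le_lt_trans _ _ (K * (e / (K + 1)))).
    rewrite ler_wpM2r ?divr_ge0 ?(ltW e0) ?(ltW K10)//.
    by rewrite ler_pdivrMr ?ltr0n// ler_peMr// ler1n.
  by rewrite mulrCA gtr_pMr// ltr_pdivrMr// mul1r ltrDl.
apply: H => // nu nut; apply: lt_le_trans (hlt nu _) _.
  by rewrite inE nut orbT.
by rewrite lee_fin ge_min lexx.
Qed.

Lemma gs_seminorm_sum_le (lambda : R) (F : nat -> gelfand_shilov om)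
    (u : nat -> R) n :
  (forall k, (0 < k)%N -> (gs_seminorm om lambda (F k) <= (u k)%:E)%E) ->
  (gs_seminorm om lambda (gs_val (\sum_(1 <= k < n.+1) F k)%R)
     <= (\sum_(1 <= k < n.+1) u k)%:E)%E.
Proof.
move=> Fu; elim: n => [|n IHn].
  by rewrite !big_geq// gs_seminorm0.
rewrite !(big_nat_recr n.+1)//.
apply: le_trans (gs_seminormD om lambda
  (gs_csmooth (\sum_(1 <= k < n.+1) F k)) (gs_csmooth (F n.+1))) _.
by rewrite EFinD leeD// Fu.
Qed.

Lemma cvg_mean_inv (c : R) :
  (fun n => n%:R^-1 * \sum_(1 <= k < n.+1) (c / k%:R)) @ \oo --> (0 : R).
Proof.
rewrite -cvg_shiftS.
have H : (fun n => c * n.+1%:R^-1) @ \oo --> (0 : R).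
  by rewrite -[X in _ --> X](mulr0 c); apply: cvgMr; exact: cvg_harmonic.
suff <- : arithmetic_mean (fun n => c * n.+1%:R^-1)
    = (fun n => n.+1%:R^-1 * \sum_(1 <= k < n.+2) (c / k%:R)) by exact: cesaro H.
by apply/funext => n; rewrite /arithmetic_mean/= /series/= [in RHS]big_add1.
Qed.

(** The limit is 0: the k-th iterate is O(1/k) in every seminorm, and Cesaro means of a null
    sequence tend to 0. *)
Lemma mean_ergodic_no_fixed_point : mean_ergodic T.
Proof.
move=> f; exists 0; apply/cvg_entourageP => E [s [e [s0 e0 sE]]].
suff : \forall n \near \oo, forall lambda, lambda \in s ->
    (gs_seminorm om lambda (gs_val (0 - cesaro_mean T f n)%R) < e%:E)%E.
  by apply: filterS => n H; apply: sE => lambda /H.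
elim: s s0 {sE} => [_|l s IHs /andP[l0 /IHs]]; first exact: nearW.
have [mu [K [mu0 K0 HK]]] := gs_seminorm_iter_le l0.
have [M fM] := gs_seminorm_fin f mu0.
have /cvgrPdist_lt/(_ e e0) := cvg_mean_inv (K * M).
apply: filterS2 => n ne H lambda; rewrite sub0r normrN in ne.
rewrite in_cons => /predU1P[->|]; last exact: H.
apply: (@le_lt_trans _ _ (n%:R^-1 * \sum_(1 <= k < n.+1) (K * M / k%:R))%:E).
  rewrite sub0r -scaleN1r gs_valZ.
  apply: le_trans (gs_seminormZ_le _ _ _ (gs_csmooth _)) _.
  rewrite normcN normc1 mul1e /cesaro_mean gs_valZ.
  apply: le_trans (gs_seminormZ_le _ _ _ (gs_csmooth _)) _.
  have -> : normc (n%:R^-1 : R[i]) = n%:R^-1.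
    by rewrite normcV -(rmorph_nat (real_complex R)) normc_real normr_nat.
  rewrite EFinM lee_wpmul2l ?lee_fin ?invr_ge0//.
  apply: gs_seminorm_sum_le => k k0.
  by rewrite mulrAC HK.
by rewrite lte_fin (le_lt_trans _ ne)// ler_norm.
Qed.

End NoFixedPoints.
End CompositionOperator.

(** * Growth at a fixed point *)

Section RepellingFixedPoint.
Variable R : realType.
Implicit Types (P g q chi : {poly R}) (x : R) (l n : nat).

Lemma lead_coef_gt0_pos q x : 0 < lead_coef q -> exists2 y, x <= y & 0 < q.[y].
Proof.
move=> q0; pose d := (size q).-1; pose r := \sum_(i < d) `|q`_i|.
pose y := 1 + `|x| + r / lead_coef q.
have r0 : 0 <= r by exact: sumr_ge0.
have rq0 : 0 <= r / lead_coef q by rewrite divr_ge0// ltW.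
have y1 : 1 <= y by have := normr_ge0 x; rewrite /y; move: (r / _) rq0 => *; lra.
exists y; first by have := ler_norm x; rewrite /y; move: (r / _) rq0 => *; lra.
have y0 : 0 < y by apply: lt_le_trans y1.
have sq : size q = d.+1.
  by rewrite prednK// size_poly_gt0 -lead_coef_eq0 gt_eqF.
rewrite horner_coef sq big_ord_recr/=.
have qd : q`_d = lead_coef q by rewrite lead_coefE.
case: d @r r0 @y rq0 y1 y0 sq qd => [|d] r r0 y rq0 y1 y0 sq qd.
  by rewrite big_ord0 add0r qd expr0 mulr1.
have low : `|\sum_(i < d.+1) q`_i * y ^+ i| <= r * y ^+ d.
  apply: le_trans (ler_norm_sum _ _ _) _; rewrite mulr_suml; apply: ler_sum => i _.
  rewrite normrM normrX (gtr0_norm y0) ler_wpM2l//.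
  by apply: ler_weXn2l => //; rewrite -ltnS ltn_ord.
apply: (@lt_le_trans _ _ (lead_coef q * y * y ^+ d - r * y ^+ d)).
  rewrite -mulrBl mulr_gt0 ?exprn_gt0// subr_gt0.
  rewrite mulrC -ltr_pdivrMr// /y; have := normr_ge0 x.
  by move: (r / _) => *; lra.
rewrite qd exprS mulrA addrC lerD2l.
by have := ler_norm (- \sum_(i < d.+1) q`_i * y ^+ i); rewrite normrN; lra.
Qed.

Lemma XsubC_exp_monic x n : ('X - x%:P) ^+ n \is monic.
Proof. by rewrite monic_exp ?monicXsubC. Qed.

(* If the cofactor q is negative at x, it changes sign further right, its leading
   coefficient being positive; then recurse on q. *)
Lemma last_root_cofactor_gt0 chi x : 0 < lead_coef chi -> root chi x ->
  exists x0 l g,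
    [/\ x <= x0, chi = ('X - x0%:P) ^+ l.+1 * g & 0 < g.[x0]].
Proof.
have [n] := ubnP (size chi).
elim: n chi x => // n IHn chi x; rewrite ltnS => sn chi0 rx.
have chi_neq0 : chi != 0 by rewrite -lead_coef_eq0 gt_eqF.
have [m [q qx chiE]] := multiplicity_XsubC chi x.
rewrite chi_neq0/= in qx.
case: m chiE => [|m] chiE.
  by move: rx; rewrite chiE expr0 mulr1 (negPf qx).
have lq : lead_coef q = lead_coef chi.
  by rewrite chiE lead_coefM (monicP (XsubC_exp_monic x m.+1)) mulr1.
have [qpos|qneg] := ltP 0 q.[x].
  by exists x, m, q; split => //; rewrite chiE mulrC.
have [y xy qy] := lead_coef_gt0_pos x (eq_ind_r (fun t => 0 < t) chi0 lq).
have [z /andP[xz _] rz] := @poly_ivt _ q x y xy (introT andP (conj qneg (ltW qy))).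
have q_neq0 : q != 0 by rewrite -lead_coef_eq0 lq gt_eqF.
have sq : (size q < n)%N.
  apply: leq_trans sn; rewrite chiE size_Mmonic ?XsubC_exp_monic//.
  by rewrite size_exp_XsubC addnS/= addnS ltnS leq_addr.
have lq0 : 0 < lead_coef q by rewrite lq.
have [x0 [l [g [zx0 qE g0]]]] := IHn q z sq lq0 rz.
have xx0 : x < x0.
  apply: lt_le_trans zx0; rewrite lt_neqAle xz andbT.
  by apply/eqP => xzE; move: qx; rewrite xzE rz.
exists x0, l, (g * ('X - x%:P) ^+ m.+1); split; first exact: ltW.
  by rewrite chiE qE mulrA.
by rewrite hornerM horner_exp !hornerE mulr_gt0// exprn_gt0// subr_gt0.
Qed.

Lemma comp_poly_opp P q : - P \Po q = - (P \Po q).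
Proof. by rewrite -sub0r comp_polyB comp_poly0 sub0r. Qed.

(** For chi = P - X this yields a fixed point with multiplier 1 + g(x0) > 1 if l = 0, and 1 if l >
    0. In even degree with negative leading coefficient, the reflected -chi(-X) has positive leading
    coefficient. *)
Lemma non_attracting_root chi x : root chi x ->
    0 < lead_coef chi \/ (lead_coef chi < 0 /\ odd (size chi)) ->
  exists x0 l g, [/\ chi = ('X - x0%:P) ^+ l.+1 * g, g.[x0] != 0
    & l = 0%N -> 0 < g.[x0]].
Proof.
move=> rx [chi0|[chi0 odd_chi]].
  have [x0 [l [g [_ chiE g0]]]] := last_root_cofactor_gt0 chi0 rx.
  by exists x0, l, g; split=> //; rewrite gt_eqF.
have sX : size (- 'X : {poly R}) = 2 by rewrite size_polyN size_polyX.
pose theta := - (chi \Po (- 'X)).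
have chiE : chi = - (theta \Po (- 'X)).
  by rewrite comp_poly_opp opprK -comp_polyA comp_poly_opp comp_polyX opprK comp_polyXr.
have lt0 : 0 < lead_coef theta.
  rewrite lead_coefN lead_coef_comp ?sX// lead_coefN lead_coefX -signr_odd.
  have -> : odd (size chi).-1 = false.
    by case: (size chi) odd_chi => //= n /negbTE.
  by rewrite mulr1 oppr_gt0.
have rt : root theta (- x).
  by rewrite /root hornerN horner_comp hornerN hornerX opprK oppr_eq0.
have [x0 [l [g [_ tE g0]]]] := last_root_cofactor_gt0 lt0 rt.
(* The sign collects the l + 1 reflected linear factors and the outer minus. *)
exists (- x0), l, ((-1) ^+ l *: (g \Po (- 'X))).
have gx : (g \Po (- 'X)).[- x0] = g.[x0] by rewrite horner_comp hornerN hornerX opprK.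
split.
- rewrite {1}chiE tE comp_polyM rmorphXn/= comp_polyB comp_polyX comp_polyC.
  have -> : - 'X - x0%:P = -1 *: ('X - (- x0)%:P) :> {poly R}.
    by rewrite scaleN1r polyCN opprK opprD.
  rewrite exprZn -scalerAl -scaleN1r scalerA -exprS -scalerAr.
  by rewrite !exprS !mulrA mulrNN !mul1r.
- by rewrite hornerZ gx mulf_neq0 ?signr_eq0// gt_eqF.
- by move=> ->; rewrite expr0 scale1r gx.
Qed.

(* All fixed points of P may be attracting (P = - X^3), but P \Po P has a positive
   leading coefficient or even degree, so beyond its extreme fixed points it moves
   points outwards on at least one side. *)
Lemma comp_square_fixed_point P x : (2 < size P)%N -> P.[x] = x ->
  exists x0 l g, [/\ P \Po P = 'X + ('X - x0%:P) ^+ l.+1 * g, g.[x0] != 0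
    & l = 0%N -> 0 < g.[x0]].
Proof.
move=> sP Px; pose chi := (P \Po P) - 'X.
pose d := (size P).-1.
have d2 : (2 <= d)%N by rewrite /d; case: (size P) sP.
have sP1 : (1 < size P)%N by apply: ltn_trans sP.
have lP : lead_coef P != 0 by rewrite lead_coef_eq0 -size_poly_gt0 ltnW.
have PP0 : P \Po P != 0.
  by rewrite -lead_coef_eq0 lead_coef_comp// mulf_neq0// expf_neq0.
have sPP : size (P \Po P) = (d * d).+1.
  by rewrite -[LHS]prednK ?size_poly_gt0// size_comp_poly.
have sX : (size (- 'X : {poly R}) < size (P \Po P))%N.
  by rewrite size_polyN size_polyX sPP ltnS; nia.
have lchi : lead_coef chi = lead_coef P ^+ d.+1.
  by rewrite lead_coefDl// lead_coef_comp// exprS.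
have schi : size chi = (d * d).+1 by rewrite size_polyDl.
have rchi : root chi x.
  by rewrite /root !hornerE horner_comp Px Px subrr.
have cond : 0 < lead_coef chi \/ (lead_coef chi < 0 /\ odd (size chi)).
  have l0 : lead_coef chi != 0 by rewrite lchi expf_neq0.
  move: l0; rewrite neq_lt => /orP[lneg|]; last by left.
  right; split=> //; rewrite schi/= oddM andbb; apply/negP => od.
  by move: lneg; rewrite lchi ltNge exprn_even_ge0//= od.
have [x0 [l [g [chiE g0 gl]]]] := non_attracting_root rchi cond.
by exists x0, l, g; split => //; rewrite -chiE addrC subrK.
Qed.

(** The quantity bounded below is the Taylor coefficient of order l + 1 of the iterate at x0; 'X
    contributes to it only when l = 0. At x0 the cofactors satisfy g_(n+1) = g + g_n if l > 0, and
    g_(n+1) = g + (1 + g) g_n if l = 0. *)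
Lemma poly_iter_cofactor P x0 l g n :
    P = 'X + ('X - x0%:P) ^+ l.+1 * g -> (l = 0%N -> 0 < g.[x0]) ->
  exists gn, poly_iter P n = 'X + ('X - x0%:P) ^+ l.+1 * gn
    /\ n%:R * `|g.[x0]| <= `|(l == 0)%:R + gn.[x0]|.
Proof.
move=> PE gl.
suff [gn [E B]] : exists gn, poly_iter P n = 'X + ('X - x0%:P) ^+ l.+1 * gn
    /\ if l == 0%N then n%:R * g.[x0] <= gn.[x0] else gn.[x0] == n%:R * g.[x0].
  exists gn; split => //; case: eqP B => [l0 B|_ /eqP ->]; last first.
    by rewrite add0r normrM normr_nat.
  rewrite (gtr0_norm (gl l0)); apply: le_trans (ler_norm _).
  by apply: le_trans B _; rewrite lerDr.
elim: n => [|n [gn [E B]]].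
  by exists 0; rewrite mulr0 addr0 horner0 mul0r; split => //; case: eqP.
exists (g + (1 + ('X - x0%:P) ^+ l * g) ^+ l.+1 * (gn \Po P)); split.
  rewrite /poly_iter iterS -/(poly_iter P n) E.
  rewrite comp_polyD comp_polyX comp_polyM rmorphXn/= comp_polyB comp_polyX comp_polyC.
  have -> : P - x0%:P = ('X - x0%:P) * (1 + ('X - x0%:P) ^+ l * g).
    by rewrite PE exprS; ring.
  by rewrite {1}PE exprMn mulrDr -addrA !mulrA.
have Px0 : P.[x0] = x0 by rewrite PE !hornerE subrr exprS !mul0r addr0.
rewrite !hornerE horner_comp Px0 subrr.
case: eqP B gl => [-> B|/eqP l0 /eqP -> _].
  move=> /(_ erefl) g0; rewrite expr0 mul1r expr1 -natr1.
  have : 0 <= gn.[x0] by apply: le_trans B; rewrite mulr_ge0// ltW.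
  by move: (gn.[x0]) B => G; nra.
by rewrite expr0n (negPf l0) mul0r addr0 expr1n mul1r -natr1; apply/eqP; ring.
Qed.

(** All corrections to 'X^(k.+2) have order at least l + k + 2 > l + 1, so this coefficient does not
    see [G], the only part that depends on the iterate. *)
Lemma coef_shift_exp (G : {poly R}) l k :
  (('X + 'X^(l.+1) * G) ^+ k.+2)`_l.+1 = ('X^(k.+2))`_l.+1.
Proof.
suff [H ->] : exists H,
    ('X + 'X^(l.+1) * G) ^+ k.+2 = 'X^(k.+2) + 'X^(l + k.+2) * H.
  by rewrite coefD coefXnM ifT ?addr0// !addnS !ltnS leq_addr.
elim: k.+2 => [|{}k [H IHk]]; first by exists 0; rewrite mulr0 addr0.
exists (G + H + 'X^l * H * G); rewrite exprS IHk addnS !exprS exprD; ring.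
Qed.

(** In the chain rule of order l + 1 at x0 only the u' term depends on n, and it grows at least
    linearly; the terms with higher derivatives of u are bounded by [coef_shift_exp]. *)
Lemma derive1n_comp_poly_iter_ge P x0 l g (u : R -> R) :
    P = 'X + ('X - x0%:P) ^+ l.+1 * g -> g.[x0] != 0 ->
    (l = 0%N -> 0 < g.[x0]) -> smooth u -> derive1 u x0 != 0 ->
  exists c C : R, 0 < c /\ forall n,
    c * n%:R - C <= `|derive1n l.+1 (u \o horner (poly_iter P n)) x0|.
Proof.
move=> PE g0 gl su u0.
pose L : R := l.+1`!%:R.
have L0 : 0 < L by rewrite ltr0n fact_gt0.
exists (`|derive1 u x0| * L * `|g.[x0]|),
  (\sum_(k < l.+2) `|derive1n k u x0| * L).
split=> [|n]; first by rewrite !mulr_gt0// normr_gt0.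
have [gn [Pn gn_ge]] := poly_iter_cofactor n PE gl.
have Pnx : (poly_iter P n).[x0] = x0.
  by rewrite Pn !hornerE subrr exprS !mul0r addr0.
pose G := gn \Po ('X + x0%:P).
have shiftE : shift_poly x0 (poly_iter P n) = 'X + 'X^(l.+1) * G.
  rewrite /shift_poly Pnx Pn comp_polyD comp_polyX comp_polyM rmorphXn/=.
  by rewrite comp_polyB comp_polyX comp_polyC addrK -/G; ring.
have bell1 : (bell (poly_iter P n) l.+1 1).[x0] = L * ((l == 0)%:R + gn.[x0]).
  have := horner_bell (poly_iter P n) l.+1 1 x0.
  rewrite mul1r => ->; congr (_ * _).
  rewrite expr1 shiftE coefD coefX coefXnM ltnn subnn eqSS; congr (_ + _).
  by rewrite -horner_coef0 horner_comp !hornerE.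
have bell0 : (bell (poly_iter P n) l.+1 0).[x0] = 0.
  have := horner_bell (poly_iter P n) l.+1 0 x0.
  by rewrite mul1r => ->; rewrite expr0 coef1 mulr0.
have bell2 k : `|(bell (poly_iter P n) l.+1 k.+2).[x0]| <= L.
  apply: (@le_trans _ _ (k.+2`!%:R * `|(bell (poly_iter P n) l.+1 k.+2).[x0]|)).
    by rewrite ler_peMl// ler1n fact_gt0.
  rewrite -[X in X * _]normr_nat -normrM horner_bell shiftE coef_shift_exp normrM.
  rewrite normr_nat coefXn normr_nat -/L.
  by case: eqP; rewrite ?mulr1// mulr0 ltW.
set C := \sum_(k < l.+2) _.
rewrite derive1n_comp_horner// Pnx 2!big_ord_recl [bell]lock/= -lock.
rewrite bell0 mulr0 add0r bell1.
set tl := \sum_(i < l) _.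
have tl_le : `|tl| <= C.
  rewrite /C; apply: le_trans (ler_norm_sum _ _ _) _.
  rewrite !big_ord_recl/= addrA ler_wpDl ?addr_ge0 ?mulr_ge0 ?(ltW L0)//.
  by apply: ler_sum => i _; rewrite normrM ler_wpM2l// bell2.
have main : `|derive1 u x0| * L * `|g.[x0]| * n%:R
    <= `|derive1 u x0 * (L * ((l == 0)%:R + gn.[x0]))|.
  rewrite !normrM (gtr0_norm L0) -!mulrA ler_wpM2l// ler_wpM2l ?(ltW L0)//.
  by rewrite mulrC.
by have := lerB_normD (derive1 u x0 * (L * ((l == 0)%:R + gn.[x0]))) tl; lra.
Qed.

End RepellingFixedPoint.

(** * Gaussians as test functions *)

Section Gaussian.
Variable R : realType.
Implicit Types (c x : R).

Definition gaussian_exponent c : {poly R} := - ('X - c%:P) ^+ 2.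

(** Written as a composition with a polynomial so that the chain rule and the [bell] estimates apply
    to its derivatives. *)
Definition gaussian c : R -> R := expR \o horner (gaussian_exponent c).

Lemma derive1n_expR n : derive1n n (@expR R) = @expR R.
Proof.
elim: n => // n IHn; rewrite derive1nS IHn; apply/funext => x.
by rewrite derive1E; apply: derive_val.
Qed.

Lemma smooth_expR : smooth (@expR R).
Proof. by move=> n x; rewrite derive1n_expR; exact: derivable_expR. Qed.

Lemma smooth_gaussian c : smooth (gaussian c).
Proof. exact: (@smooth_comp_horner _ _ (gaussian_exponent c) smooth_expR). Qed.

Lemma horner_gaussian_exponent c x : (gaussian_exponent c).[x] = - (x - c) ^+ 2.
Proof. by rewrite !hornerE. Qed.

Lemma derive1_gaussian_neq0 c : derive1 (gaussian c) (c + 1) != 0.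
Proof.
have -> : derive1 (gaussian c) = derive1n 1 (gaussian c) by [].
rewrite derive1n_comp_horner; last exact: smooth_expR.
rewrite big_ord_recl big_ord1 !derive1n_expR/= deriv0 derivC.
rewrite addr0 add0r horner0 mulr0 add0r mulr1.
apply: mulf_neq0; first by rewrite gt_eqF// expR_gt0.
rewrite /gaussian_exponent derivN expr2 derivM derivB derivX derivC !hornerE.
by rewrite oppr_eq0 (_ : _ + _ = 2); [|ring].
Qed.

Lemma exp1D_le_fact (v : R) N : 0 <= v ->
  (1 + v) ^+ N * expR (- v) <= expR 1 * N`!%:R.
Proof.
move=> v0; rewrite expRN ler_pdivrMr ?expR_gt0// mulrAC -expRD.
have N0 : 0 < N`!%:R :> R by rewrite ltr0n fact_gt0.
case: N N0 => [|N] N0.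
  by rewrite expr0 mulr1 -expR0 ler_expR addr_ge0.
rewrite -ler_pdivrMr//; apply: le_trans (expR_ge1Dxn N _); last by rewrite addr_ge0.
by rewrite lerDr.
Qed.

Lemma gaussian_derive_le c n x :
  `|derive1n n (gaussian c) x|
    <= n.+1`!%:R * (1 + coef_norm (gaussian_exponent c)) ^+ n
       * (1 + `|x|) ^+ (2 * n) * expR (- (x - c) ^+ 2).
Proof.
have sP : size (gaussian_exponent c) = 3 by rewrite size_polyN size_exp_XsubC.
have L1 := expansion_rate_ge1 (gaussian_exponent c) x.
have L0 := lt_le_trans ltr01 L1.
pose s := (expansion_rate (gaussian_exponent c) x)^-1.
have s0 : 0 < s by rewrite invr_gt0.
have ex : expands_within (gaussian_exponent c) x s 1.
  rewrite -[X in expands_within _ _ _ X](mulVf (lt0r_neq0 L0)).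
  by apply: expands_within_rate; rewrite ltW//= invf_le1.
rewrite derive1n_comp_horner; last exact: smooth_expR.
apply: le_trans (ler_norm_sum _ _ _) _.
apply: (@le_trans _ _ (\sum_(k < n.+1)
    expR (- (x - c) ^+ 2) * (n`!%:R * s^-1 ^+ n))).
  apply: ler_sum => k _.
  rewrite normrM derive1n_expR horner_gaussian_exponent gtr0_norm ?expR_gt0//.
  by rewrite ler_wpM2l ?expR_ge0// horner_bell_le.
rewrite sumr_const card_ord invrK /expansion_rate sP exprMn -exprM.
by rewrite -[leLHS]mulr_natl factS natrM le_eqVlt; apply/orP; left; apply/eqP; ring.
Qed.

Definition cgaussian c : R -> R[i] := fun x => ((gaussian c x)%:C)%C.

Lemma derive1n_cst0 n : derive1n n (fun=> 0 : R) = fun=> 0.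
Proof.
elim: n => // n IHn; rewrite derive1nS IHn; apply/funext => x.
by rewrite derive1_cst.
Qed.

Lemma csmooth_cgaussian c : csmooth (cgaussian c).
Proof.
split; first exact: smooth_gaussian.
by move=> n x; rewrite /= derive1n_cst0; exact: derivable_cst.
Qed.

Lemma normc_cderive_cgaussian c n x :
  normc (cderive n (cgaussian c) x) = `|derive1n n (gaussian c) x|.
Proof. by rewrite /cderive/= derive1n_cst0 expr0n/= addr0 sqrtr_sqr. Qed.

(** Powers of 1 + |x| become powers of 1 + v with v = (x - c)^2, which exp (-v) turns into a second
    factorial; each factorial is absorbed by half of [a]. *)
Lemma gs_bound_gaussian c a r : 0 < a -> 1 < r ->
  exists M, gs_bound a r M (cgaussian c).
Proof.
move=> a0 r1; have a20 : 0 < a / 2 by lra.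
pose K : R := 1 + coef_norm (gaussian_exponent c); pose B := 2 * (1 + `|c|) ^+ 2.
have K1 : 1 <= K by rewrite lerDl coef_norm_ge0.
have B0 : 0 <= B by rewrite mulr_ge0 ?exprn_ge0.
have KB0 : 0 <= K * B by rewrite mulr_ge0// (le_trans _ K1).
have [K1' K10 HK1] := fact_exp_le_expR_powR a20 r1 ler01.
have [K2 K20 HK2] := fact_exp_le_expR_powR a20 r1 KB0.
exists (expR 1 * K1' * K2) => x n q; rewrite normc_cderive_cgaussian.
set N := (n + q)%N; pose v := (x - c) ^+ 2; pose t := 1 + `|x|.
have v0 : 0 <= v by rewrite sqr_ge0.
have t1 : 1 <= t by rewrite lerDl.
have tge0 : 0 <= t by apply: le_trans t1.
have tB : t ^+ 2 <= B * (1 + v).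
  have : `|x| <= `|c| + `|x - c|.
    by rewrite addrC; have := ler_normD (x - c) c; rewrite subrK.
  rewrite /t /B /v -[(x - c) ^+ 2]real_normK ?num_real//.
  have := normr_ge0 x; have := normr_ge0 c; have := normr_ge0 (x - c).
  move: `|x| `|c| `|x - c| => X C D D0 C0 X0 XCD.
  apply: (@le_trans _ _ ((1 + C + D) ^+ 2)).
    by rewrite lerXn2r ?nnegrE; lra.
  have E1 : 1 <= (1 + C) ^+ 2 by rewrite exprn_ege1// lerDl.
  rewrite -subr_ge0.
  have -> : 2 * (1 + C) ^+ 2 * (1 + D ^+ 2) - (1 + C + D) ^+ 2
    = (1 + C - D) ^+ 2 + 2 * (D ^+ 2 * ((1 + C) ^+ 2 - 1)) by ring.
  by rewrite addr_ge0 ?sqr_ge0// !mulr_ge0 ?sqr_ge0// subr_ge0.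
apply: le_trans (ler_wpM2l (exprn_ge0 q tge0) (gaussian_derive_le c n x)) _.
rewrite -/K -/t -/v.
have KN : K ^+ n <= K ^+ N by apply: ler_weXn2l => //; rewrite leq_addr.
have tN : t ^+ q * t ^+ (2 * n) <= B ^+ N * (1 + v) ^+ N.
  rewrite -exprD -exprMn; apply: (@le_trans _ _ ((t ^+ 2) ^+ N)).
    by rewrite -exprM; apply: ler_weXn2l => //; rewrite mulnDr addnC leq_add2l leq_pmull.
  by rewrite lerXn2r ?nnegrE ?exprn_ge0// mulr_ge0// addr_ge0.
have fN : n.+1`!%:R <= N.+1`!%:R :> R by rewrite ler_nat leq_fact// ltnS leq_addr.
apply: (@le_trans _ _ (N.+1`!%:R * K ^+ N * (B ^+ N * (1 + v) ^+ N) * expR (- v))).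
  have -> : t ^+ q * (n.+1`!%:R * K ^+ n * t ^+ (2 * n) * expR (- v))
     = n.+1`!%:R * K ^+ n * (t ^+ q * t ^+ (2 * n)) * expR (- v).
    move: (t ^+ q) (t ^+ (2 * n)) (K ^+ n) (expR (- v)) (n.+1`!%:R : R) => *; ring.
  rewrite ler_wpM2r ?expR_ge0//.
  have Kn0 : 0 <= K ^+ n by rewrite exprn_ge0// (le_trans _ K1).
  by apply: ler_pM => //; [rewrite mulr_ge0|rewrite mulr_ge0 ?exprn_ge0|apply: ler_pM].
have -> : N.+1`!%:R * K ^+ N * (B ^+ N * (1 + v) ^+ N) * expR (- v)
   = (N.+1`!%:R * (K * B) ^+ N) * ((1 + v) ^+ N * expR (- v)).
  rewrite [(K * B) ^+ N]exprMn.
  move: (K ^+ N) (B ^+ N) ((1 + v) ^+ N) (expR (- v)) (N.+1`!%:R : R) => *.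
  by ring.
have -> : expR 1 * K1' * K2 * expR (a * N%:R `^ r)
   = (K2 * expR (a / 2 * N%:R `^ r)) * (expR 1 * (K1' * expR (a / 2 * N%:R `^ r))).
  have -> : a * N%:R `^ r = a / 2 * N%:R `^ r + a / 2 * N%:R `^ r by lra.
  by rewrite expRD; move: (expR (a / 2 * _)) (expR 1) => E1 E2; ring.
apply: ler_pM; rewrite ?HK2//.
- by rewrite mulr_ge0// exprn_ge0.
- by rewrite mulr_ge0 ?expR_ge0// exprn_ge0// addr_ge0.
apply: le_trans (exp1D_le_fact N v0) _; rewrite ler_wpM2l ?expR_ge0//.
apply: le_trans (HK1 N); rewrite expr1n mulr1 ler_nat leq_fact//.
Qed.

End Gaussian.

(** * Sublinear orbits exclude fixed points *)

Section FixedPoints.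
Variables (R : realType) (p : R).
Hypothesis p1 : 1 < p.
Let om := log_power_weight p.
Variable psi : {poly R}.
Hypothesis hpsi : (2 < size psi)%N.
Let T : gelfand_shilov om -> gelfand_shilov om :=
  composition_operator (fun x : R => psi.[x]).
Implicit Types (f g h : gelfand_shilov om) (c : R[i]).

Lemma gs_seminorm_lincomb_le (lambda : R) c1 c2 f1 f2 (M1 M2 : R) :
  (gs_seminorm om lambda (gs_val f1) <= M1%:E)%E ->
  (gs_seminorm om lambda (gs_val f2) <= M2%:E)%E ->
  (gs_seminorm om lambda (gs_val (c1 *: f1 + c2 *: f2)%R)
    <= (normc c1 * M1 + normc c2 * M2)%:E)%E.
Proof.
move=> H1 H2; rewrite gs_valD !gs_valZ.
have s1 := csmoothZ c1 (gs_csmooth f1); have s2 := csmoothZ c2 (gs_csmooth f2).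
apply: le_trans (gs_seminormD om lambda s1 s2) _.
rewrite EFinD; apply: leeD.
  apply: le_trans (gs_seminormZ_le om lambda c1 (gs_csmooth f1)) _.
  by rewrite EFinM lee_wpmul2l// lee_fin normc_ge0.
apply: le_trans (gs_seminormZ_le om lambda c2 (gs_csmooth f2)) _.
by rewrite EFinM lee_wpmul2l// lee_fin normc_ge0.
Qed.

Lemma gs_seminormZ_fin (lambda : R) c f (M : R) :
  (gs_seminorm om lambda (gs_val f) <= M%:E)%E ->
  (gs_seminorm om lambda (gs_val (c *: f)%R) <= (normc c * M)%:E)%E.
Proof.
move=> H; rewrite gs_valZ.
apply: le_trans (gs_seminormZ_le om lambda c (gs_csmooth f)) _.
by rewrite EFinM lee_wpmul2l// lee_fin normc_ge0.
Qed.

Lemma iter_compositionZ m c f : iter m T (c *: f) = c *: iter m T f.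
Proof.
apply: val_inj; rewrite -[LHS]/(gs_val _) -[RHS]/(gs_val _).
by rewrite gs_val_iter// !gs_valZ gs_val_iter.
Qed.

(** Equicontinuity at 0 controls the orbit of a small multiple d f; dividing by [d] gives the bound
    1/d for f. *)
Lemma power_bounded_orbit (lambda : R) f : 0 < lambda -> power_bounded T ->
  exists M : R, forall m, (0 < m)%N ->
    (gs_seminorm om lambda (gs_val (iter m T f)) <= M%:E)%E.
Proof.
move=> l0 pbT.
pose E := @gs_basic_entourage R om [:: lambda] 1.
have entE : @gs_entourage R om E.
  by exists [:: lambda], 1; split; rewrite /= ?l0.
have [V [t [e [t0 e0 tV]]] VA] : nbhs_ entourage (0 : gelfand_shilov om)
    [set g | forall m, (0 < m)%N -> E (iter m T 0, iter m T g)].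
  by apply/nbhsP; exact: (pbT 0 E entE).
have [d d0 dt] : exists2 d : R, 0 < d & forall mu, mu \in t ->
    (gs_seminorm om mu (gs_val (0 - d%:C%C *: f)%R) < e%:E)%E.
  have [D D0 HD] : exists2 D : R, 0 <= D & forall mu, mu \in t ->
      (gs_seminorm om mu (gs_val f) <= D%:E)%E.
    elim: t t0 {tV} => [_|mu t IHt /andP[mu0 /IHt[D D0 HD]]]; first by exists 0.
    have [M fM] := gs_seminorm_fin f mu0.
    exists (Num.max D M) => [|nu]; first by rewrite le_max D0.
    rewrite in_cons => /predU1P[->|/HD fD].
      by apply: le_trans fM _; rewrite lee_fin le_max lexx orbT.
    by apply: le_trans fD _; rewrite lee_fin le_max lexx.
  exists (e / (D + 1)); first by rewrite divr_gt0// ltr_wpDl.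
  move=> mu /HD fD; rewrite sub0r -scaleNr.
  apply: le_lt_trans (gs_seminormZ_fin _ fD) _.
  rewrite normcN normc_real ger0_norm ?divr_ge0 ?(ltW e0) ?addr_ge0//.
  rewrite lte_fin mulrAC -mulrA gtr_pMr// ltr_pdivrMr ?mul1r ?ltrDl//.
  by rewrite ltr_wpDl.
exists d^-1 => m m0.
have fV : (d%:C%C *: f)
    \in [set g | forall m, (0 < m)%N -> E (iter m T 0, iter m T g)].
  by apply/mem_set/VA/mem_set; apply: tV => mu /dt.
have /(_ m m0 lambda) := set_mem fV.
rewrite mem_seq1 => /(_ (eqxx _)).
rewrite -[X in (gs_seminorm _ _ (gs_val X) < _)%E]
  /(iter m T 0 - iter m T (d%:C%C *: f)).
rewrite -iter_compositionB// sub0r -scaleNr iter_compositionZ => H.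
have -> : iter m T f = (- d%:C%C)^-1 *: ((- d%:C%C) *: iter m T f).
  rewrite scalerA mulVf ?scale1r// oppr_eq0.
  by apply/eqP => -[] /eqP; rewrite gt_eqF.
apply: le_trans (gs_seminormZ_fin _ (ltW H)) _.
by rewrite lee_fin mulr1 normcV normcN normc_real gtr0_norm.
Qed.

Lemma mean_ergodic_orbit (lambda e : R) f : 0 < lambda -> 0 < e ->
  mean_ergodic T -> \forall m \near \oo,
    (gs_seminorm om lambda (gs_val (iter m T f)) <= (e * m%:R)%:E)%E.
Proof.
move=> l0 e0 /(_ f)[y /cvg_entourageP cy].
(* The two mean errors cost (2 m + 1) e / 4 and the seminorm of [y] at most e m / 2, in total at
   most e (m + 1). *)
have e40 : 0 < e / 4 by rewrite divr_gt0.
pose E := @gs_basic_entourage R om [:: lambda] (e / 4).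
have entE : @gs_entourage R om E.
  by exists [:: lambda], (e / 4); split; rewrite /= ?l0.
have [N _ HN] := cy E entE.
have [S yS] := gs_seminorm_fin y l0.
have C_le n : (N <= n)%N ->
    (gs_seminorm om lambda (gs_val (y - cesaro_mean T f n)%R) <= (e / 4)%:E)%E.
  by move=> /HN /(_ lambda); rewrite mem_seq1 => /(_ (eqxx _)) /ltW.
have [K eK] : exists K : nat, 2 * S / e <= K%:R.
  by exists (Num.trunc (2 * S / e)).+1; apply: ltW; rewrite Num.Theory.truncnS_gt.
exists (N + K).+1; first by [].
move=> [|m] NKm0; first by [].
have NKm : (N + K <= m)%N by exact: NKm0.
have nC n : \sum_(1 <= k < n.+1) iter k T f = n%:R *: cesaro_mean T f n.
  case: n => [|n]; first by rewrite big_geq// scale0r.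
  by rewrite /cesaro_mean scalerA mulfV ?scale1r// pnatr_eq0.
(* T^(m+1) f = (m + 1) C_(m+1) - m C_m for the Cesaro means C_m, which tend to y. *)
have iterE : iter m.+1 T f =
    1 *: y + 1 *: ((- m.+1%:R) *: (y - cesaro_mean T f m.+1)
                 + m%:R *: (y - cesaro_mean T f m)).
  have -> : iter m.+1 T f =
      \sum_(1 <= k < m.+2) iter k T f - \sum_(1 <= k < m.+1) iter k T f.
    by rewrite (big_nat_recr m.+1)// addrAC subrr add0r.
  have yE : m.+1%:R *: y = m%:R *: y + y by rewrite -natr1 scalerDl scale1r.
  rewrite !nC !scale1r !scalerBr !scaleNr opprK yE.
  rewrite addrACA opprD [_ - _ + m%:R *: y]addrAC addNr sub0r.
  by rewrite [RHS]addrA subrr add0r.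
rewrite iterE.
have H1 := C_le m.+1 (leq_trans (leq_addr K N) (leqW NKm)).
have H2 := C_le m (leq_trans (leq_addr K N) NKm).
apply: le_trans (gs_seminorm_lincomb_le _ _ yS (gs_seminorm_lincomb_le _ _ H1 H2)) _.
have nat_norm k : normc (k%:R : R[i]) = k%:R.
  by rewrite -(rmorph_nat (real_complex R)) normc_real normr_nat.
rewrite lee_fin normcN !nat_norm normc1 !mul1r.
have : 2 * S <= e * m%:R.
  rewrite [leRHS]mulrC -ler_pdivrMr//; apply: le_trans eK _.
  by rewrite ler_nat (leq_trans (leq_addl N K)).
by rewrite -[m.+1%:R]natr1; move: (m%:R : R) => X; lra.
Qed.

Lemma Re_derive_le (lambda M : R) h l x : 0 < lambda ->
  (gs_seminorm om lambda (gs_val h) <= M%:E)%E ->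
  `|derive1n l (fun y => complex.Re (gs_val h y)) x|
    <= M * expR (gs_rate p lambda * l%:R `^ conj_exp p).
Proof.
move=> l0 /(gs_seminorm_leP p1 _ _ l0)/(_ x l 0); rewrite expr0 mul1r addn0.
apply: le_trans; rewrite /cderive/= -sqrtr_sqr.
by rewrite ler_wsqrtr// lerDl sqr_ge0.
Qed.

Lemma poly_iter_double n :
  horner (poly_iter psi n.*2) = horner (poly_iter (psi \Po psi) n).
Proof.
elim: n => [|n IHn]; first by [].
by apply/funext => x; rewrite doubleS !horner_poly_iterS IHn horner_comp.
Qed.

Lemma gs_gaussian (a : R) : exists f, gs_val f = cgaussian a.
Proof.
have gP : cgaussian a \in gs_pred om.
  apply/gs_predP; split; first exact: csmooth_cgaussian.
  move=> lambda l0.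
  have [M gM] := gs_bound_gaussian a (gs_rate_gt0 p1 l0) (conj_exp_gt1 p1).
  by apply: le_lt_trans (ltry M); apply/(gs_seminorm_leP p1 _ _ l0).
by exists (GelfandShilov gP).
Qed.

(** Along even times the iterates are those of psi \o psi, and a seminorm bounds the derivatives at
    its non-attracting fixed point x0. The Gaussian is centred at x0 - 1 to have nonzero slope at
    x0. *)
Lemma fixed_point_orbit_growth x : psi.[x] = x -> exists f,
  ~ forall e : R, 0 < e -> \forall m \near \oo,
      (gs_seminorm om 1 (gs_val (iter m T f)) <= (e * m%:R)%:E)%E.
Proof.
move=> /(comp_square_fixed_point hpsi)[x0 [l [g [psi2E g0 gl]]]].
have u0 : derive1 (gaussian (x0 - 1)) x0 != 0.
  by have := derive1_gaussian_neq0 (x0 - 1); rewrite subrK.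
have [c [C [cgt0 growth]]] :=
  derive1n_comp_poly_iter_ge psi2E g0 gl (@smooth_gaussian _ (x0 - 1)) u0.
have [f fE] := gs_gaussian (x0 - 1).
exists f => sublinear.
pose W := expR (gs_rate p 1 * l.+1%:R `^ conj_exp p).
have W0 : 0 < W := expR_gt0 _.
(* At time 2 n the sublinear bound becomes c n / 2, which is below c n - C as soon as n > 2 C /
   c. *)
have e0 : 0 < c / (4 * W) by rewrite divr_gt0// mulr_gt0.
have [N _ HN] := sublinear _ e0.
have [K CK] : exists K : nat, 2 * C / c < K%:R.
  by exists (Num.trunc (2 * C / c)).+1; rewrite Num.Theory.truncnS_gt.
pose n := (N + K)%N.
have Nn : (N <= n.*2)%N by rewrite -addnn -addnA leq_addr.
have := Re_derive_le l.+1 x0 ltr01 (HN _ Nn).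
rewrite gs_val_iter// fE poly_iter_double -/W.
move=> /(le_trans (growth n)).
have -> : c / (4 * W) * n.*2%:R * W = c / 2 * n%:R.
  by rewrite -muln2 natrM; field; rewrite gt_eqF.
have : 2 * C < c * n%:R.
  rewrite [ltRHS]mulrC -ltr_pdivrMr//; apply: lt_le_trans CK _.
  by rewrite ler_nat leq_addl.
by move: (n%:R : R) => X; lra.
Qed.

Lemma power_bounded_fixed_point_free : power_bounded T -> ~ exists x, psi.[x] = x.
Proof.
move=> pbT [x /fixed_point_orbit_growth[f]]; apply => e e0.
have [M fM] := power_bounded_orbit f ltr01 pbT.
exists (Num.trunc (M / e)).+1 => //= m Mm.
apply: le_trans (fM m (leq_trans _ Mm)) _ => //.
rewrite lee_fin mulrC -ler_pdivrMr//; apply: ltW.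
apply: (@lt_le_trans _ _ (Num.trunc (M / e)).+1%:R); last by rewrite ler_nat.
by rewrite Num.Theory.truncnS_gt.
Qed.

Lemma mean_ergodic_fixed_point_free : mean_ergodic T -> ~ exists x, psi.[x] = x.
Proof.
move=> meT [x /fixed_point_orbit_growth[f]]; apply => e e0.
exact: mean_ergodic_orbit.
Qed.

End FixedPoints.

Theorem corollary3p5 (R : realType) (p : R) (hp : 1 < p)
    (psi : {poly R}) (hpsi : (2 < size psi)%N) :
  let omega := log_power_weight p in
  let C_psi : gelfand_shilov omega -> gelfand_shilov omega :=
    composition_operator (fun x : R => psi.[x]) in
  (power_bounded C_psi <-> ~ exists x : R, psi.[x] = x) /\
  ((~ exists x : R, psi.[x] = x) <-> mean_ergodic C_psi).
Proof.
split; split.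
- exact: power_bounded_fixed_point_free.
- exact: power_bounded_no_fixed_point.
- exact: mean_ergodic_no_fixed_point.
- exact: mean_ergodic_fixed_point_free.
Qed.
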